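(* Let $\{x_k\}$ be generated by the algorithm RDS-DD described in the context, with associated directions $\{d_k\}$. If $\{x_{i(k)}\}$ is a refining subsequence with $x_{i(k)}\to x^*\in\mathcal M$, and $i(k)$ is an unsuccessful iteration for every $k\in\mathbb N\cup\{0\}$, then $x^*$ is Clarke stationary for $f$.
   Context: Setting. $\mathcal M$ is a smooth manifold embedded in $\mathbb R^n$, equipped with a Riemannian metric $\langle\cdot,\cdot\rangle_x$ on $T_x\mathcal M$ depending smoothly on $x$, with norm $\|\cdot\|_x$. $\operatorname{dist}(x,y)$ is the length of the shortest geodesic connecting $x,y\in\mathcal M$; $\Gamma_x^y:T_x\mathcal M\to T_y\mathcal M$ is parallel transport with respect to the Levi-Civita connection along a (fixed) shortest geodesic from $x$ to $y$, the same geodesic reversed being used for $\Gamma_y^x$. For $v\in T_x\mathcal M$, $w\in T_y\mathcal M$, $\operatorname{dist}^*(v,w)=\|v-\Gamma_y^xw\|_x=\|w-\Gamma_x^yv\|_y$. For $v_k\in T_{y_k}\mathcal M$ and $v\in T_y\mathcal M$, $v_k\to v$ means $y_k\to y$ and $\operatorname{dist}^*(v_k,v)\to0$. $\mathsf P_x$ is the orthogonal projection from $\mathbb R^n$ onto $T_x\mathcal M$, and $S(0,1)$ is the unit sphere of $\mathbb R^n$. Assumptions. $f:\mathcal M\to\mathbb R$ is Lipschitz continuous and bounded below. $R\in C^1(T\mathcal M,\mathcal M)$ is a retraction ($R(x,0)=x$ and the differential of $R(x,\cdot)$ at $0$ is the identity of $T_x\mathcal M$) and there is $L_r>0$ with $\operatorname{dist}(R(x,d),x)\le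 L_r\|d\|_x$ for all $(x,d)\in T\mathcal M$. Clarke stationarity. For a chart $(\varphi,U)$ at $x$ and $v\in T_x\mathcal M$, with $\tilde f=f\circ\varphi^{-1}$, the Clarke directional derivative is $f^\circ(x,v)=\tilde f^\circ(\varphi(x),d\varphi(x)v)$, where for locally Lipschitz $h$ on an open subset of $\mathbb R^m$, $h^\circ(y,w)=\limsup_{z\to y,\ t\downarrow0}\frac{h(z+tw)-h(z)}{t}$. A point $x^*$ is Clarke stationary if $f^\circ(x^*,d)\ge0$ for every $d\in T_{x^*}\mathcal M$. Refining subsequence. Given a sequence $(x_k,d_k)$ in $T\mathcal M$, the subsequence $\{x_{i(k)}\}$ is refining if $x_{i(k)}\to x$ for some $x\in\mathcal M$ and, for every $d\in T_x\mathcal M$ with $\|d\|_x=1$, there is a further subsequence $\{j(i(k))\}$ of the indices with $d_{j(i(k))}\to d$. Algorithm RDS-DD. Input: $x_0\in\mathcal M$, $\alpha_0>0$, $\gamma>0$, $\gamma_1\in(0,1)$, $\gamma_2\ge1$, and a sequence $\{\bar d_k\}$ dense in $S(0,1)$. For $k=0,1,2,\dots$: let $d_k=\mathsf P_{x_k}(\bar d_k)/\|\mathsf P_{x_k}(\bar d_k)\|_{x_k}$ if $\mathsf P_{x_k}(\bar d_k)\ne0$ and $d_k=0$ otherwise. If $f(R(x_k,\alpha_kd_k))\le f(x_k)-\gamma\alpha_k^2$, set $x_{k+1}=R(x_k,\alpha_kd_k)$ and $\alpha_{k+1}=\gamma_2\alpha_k$ (successful iteration); otherwise set $x_{k+1}=x_k$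 and $\alpha_{k+1}=\gamma_1\alpha_k$ (unsuccessful iteration). *)

(* Defs.v *)
From HB Require Import structures.
From mathcomp Require Import all_boot all_order all_algebra.
From mathcomp Require Import all_classical all_reals all_analysis.

Set Implicit Arguments.
Unset Strict Implicit.
Unset Printing Implicit Defensive.

Import Order.TTheory GRing.Theory Num.Theory.
Import numFieldNormedType.Exports.

Local Open Scope classical_set_scope.
Local Open Scope ring_scope.

(* C^k maps on an open set [U]; between finite-dimensional spaces, continuity
   of every directional derivative is continuity of the differential. *)
Fixpoint Ck (R : realType) (V W : normedModType R) (k : nat) (U : set V)
    (h : V -> W) : Prop :=
  match k with
  | 0 => forall x, U x -> {for x, continuous h}
  | k'.+1 => (forall x, U x -> differentiable h x) /\
             (forall v : V, Ck k' U ('D_v h))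
  end.

Definition smooth_on (R : realType) (V W : normedModType R) (U : set V)
    (h : V -> W) : Prop := forall k, Ck k U h.

(* The normed-module structure of ['rV_n] is the sup norm; it is only used for
   topology and differentiation. Euclidean notions go through [dotv]. *)
Definition dotv (R : realType) (n : nat) (u v : 'rV[R]_n) : R :=
  \sum_(i < n) u 0 i * v 0 i.

Definition sphere (R : realType) (n : nat) : set 'rV[R]_n :=
  [set u | dotv u u = 1].

Section EmbeddedManifold.
Context {R : realType} {n m : nat}.
Implicit Types (M : set 'rV[R]_n) (x y v w : 'rV[R]_n).

(* A chart of a subset of R^n: [phi] is the restriction to [M `&` U] of
   [ch_map], whose inverse is [ch_inv : ch_img -> M `&` U]. *)
Record chart := Chart {
  ch_dom : set 'rV[R]_n;
  ch_img : set 'rV[R]_m;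
  ch_map : 'rV[R]_n -> 'rV[R]_m;
  ch_inv : 'rV[R]_m -> 'rV[R]_n }.

Definition is_chart M (ch : chart) : Prop :=
  [/\ open (ch_dom ch) /\ open (ch_img ch),
      smooth_on (ch_dom ch) (ch_map ch),
      smooth_on (ch_img ch) (ch_inv ch),
      (forall x, M x -> ch_dom ch x ->
         ch_img ch (ch_map ch x) /\ ch_inv ch (ch_map ch x) = x) &
      (forall u, ch_img ch u ->
         [/\ M (ch_inv ch u), ch_dom ch (ch_inv ch u) &
             ch_map ch (ch_inv ch u) = u])].

Definition chart_at M x (ch : chart) : Prop := is_chart M ch /\ ch_dom ch x.

Definition embedded_manifold M : Prop :=
  forall x, M x -> exists ch : chart, chart_at M x ch.

Definition tangent M x : set 'rV[R]_n :=
  [set v | exists c : R -> 'rV[R]_n,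
     [/\ c 0 = x, (\forall t \near (0 : R), M (c t)) &
         is_derive (0 : R) (1 : R) c v]].

Definition is_orthproj (T : set 'rV[R]_n) v p : Prop :=
  T p /\ forall w, T w -> dotv (v - p) w = 0.

(* The set is a singleton when [T] is a linear subspace. *)
Definition orthproj (T : set 'rV[R]_n) v : 'rV[R]_n :=
  xget 0 [set p | is_orthproj T v p].

(* Only the values of a metric [g] at points of [M] and on tangent vectors
   are meaningful. *)
Definition metric := 'rV[R]_n -> 'rV[R]_n -> 'rV[R]_n -> R.
Implicit Type g : metric.

Definition ebasis (i : 'I_m) : 'rV[R]_m := delta_mx 0 i.

Definition gram g (ch : chart) (u : 'rV[R]_m) : 'M[R]_m :=
  \matrix_(i, j) g (ch_inv ch u) ('d (ch_inv ch) u (ebasis i))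
                                 ('d (ch_inv ch) u (ebasis j)).

Definition riemannian_metric M g : Prop :=
  [/\ (forall x, M x -> forall (a : R) u v w,
         tangent M x u -> tangent M x v -> tangent M x w ->
         g x (a *: u + v) w = a * g x u w + g x v w),
      (forall x, M x -> forall v w,
         tangent M x v -> tangent M x w -> g x v w = g x w v),
      (forall x, M x -> forall v, tangent M x v -> v != 0 -> 0 < g x v v) &
      (forall ch, is_chart M ch -> forall i j,
         smooth_on (ch_img ch) (fun u => (gram g ch u i j : R^o)))].

Definition riem_norm g x v : R := Num.sqrt (g x v v).

(* Christoffel symbols of the Levi-Civita connection:
   Gamma^k_ij = 1/2 sum_l G^kl (d_i G_jl + d_j G_il - d_l G_ij). *)
Definition christoffel g (ch : chart) (u : 'rV[R]_m) (k i j : 'I_m) : R :=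
  let dG (l a b : 'I_m) : R :=
    'D_(ebasis l) (fun z : 'rV[R]_m => (gram g ch z a b : R^o)) u in
  2^-1 * \sum_(l < m) invmx (gram g ch u) k l * (dG i j l + dG j i l - dG l i j).

(* Curves parametrized by [0, 1] are taken defined on a slightly larger open
   interval, so that their derivatives at 0 and 1 are two-sided. *)
Definition unit_nbhd (e : R) : set R := [set t | - e < t < 1 + e].

(* [V] is a parallel vector field along [c]: the covariant derivative
   w_k' + sum_ij Gamma^k_ij u_i' w_j vanishes in every chart. *)
Definition parallel M g (e : R) (c V : R -> 'rV[R]_n) : Prop :=
  forall t, unit_nbhd e t ->
    tangent M (c t) (V t) /\
    forall ch, chart_at M (c t) ch ->
      let u : R -> 'rV[R]_m := fun s => ch_map ch (c s) in
      let w : R -> 'rV[R]_m := fun s => 'd (ch_map ch) (c s) (V s) in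
      derivable w t 1 /\
      forall k, (derive1 w t) 0 k +
        \sum_(i < m) \sum_(j < m)
          christoffel g ch (u t) k i j * (derive1 u t) 0 i * w t 0 j = 0.

Definition curve_of_class (k : nat) M (e : R) (c : R -> 'rV[R]_n) : Prop :=
  Ck k (unit_nbhd e : set R^o) c /\ forall t, unit_nbhd e t -> M (c t).

Definition geodesic M g (c : R -> 'rV[R]_n) : Prop :=
  exists e : R, [/\ 0 < e, curve_of_class 2 M e c & parallel M g e c (derive1 c)].

Definition curve_length g (c : R -> 'rV[R]_n) : R :=
  \int[@lebesgue_measure R]_(t in `[0, 1]) riem_norm g (c t) (derive1 c t).

Definition shortest_geodesic M g x y (c : R -> 'rV[R]_n) : Prop :=
  [/\ geodesic M g c, c 0 = x, c 1 = y &
      forall (e : R) (b : R -> 'rV[R]_n), 0 < e -> curve_of_class 1 M e b ->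
        b 0 = x -> b 1 = y -> curve_length g c <= curve_length g b].

(* [geo x y] is the fixed shortest geodesic from [x] to [y]. *)
Definition geodesic_choice M g (geo : 'rV[R]_n -> 'rV[R]_n -> R -> 'rV[R]_n) :=
  forall x y, M x -> M y ->
    shortest_geodesic M g x y (geo x y) /\
    forall t, 0 <= t <= 1 -> geo y x t = geo x y (1 - t).

Section Geo.
Variables (M : set 'rV[R]_n) (g : metric).
Variable geo : 'rV[R]_n -> 'rV[R]_n -> R -> 'rV[R]_n.

Definition dist x y : R := curve_length g (geo x y).

(* The set is a singleton for [v] tangent at [x], by existence and uniqueness
   of parallel fields with a given initial value. *)
Definition ptransport x y v : 'rV[R]_n :=
  xget 0 [set w | exists (e : R) (V : R -> 'rV[R]_n),
    [/\ 0 < e, parallel M g e (geo x y) V, V 0 = v & V 1 = w]].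

(* dist^*(v, w) for v in T_x M and w in T_y M *)
Definition dist_star x v y w : R := riem_norm g y (w - ptransport x y v).

Definition tangent_cvg (y_ v_ : nat -> 'rV[R]_n) y v : Prop :=
  y_ k @[k --> \oo] --> y /\ dist_star (y_ k) (v_ k) y v @[k --> \oo] --> (0 : R).

Definition lipschitz_dist (f : 'rV[R]_n -> R) : Prop :=
  exists L : R, forall x y, M x -> M y -> `|f x - f y| <= L * dist x y.

Definition refining (x_ d_ : nat -> 'rV[R]_n) (i : nat -> nat) x : Prop :=
  [/\ {homo i : a b / (a < b)%N}, M x, x_ (i k) @[k --> \oo] --> x &
      forall d, tangent M x d -> riem_norm g x d = 1 ->
        exists2 j : nat -> nat, {homo j : a b / (a < b)%N} &
          tangent_cvg (fun k => x_ (i (j k))) (fun k => d_ (i (j k))) x d].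

End Geo.

Definition bounded_below_on M (f : 'rV[R]_n -> R) : Prop :=
  exists b : R, forall x, M x -> b <= f x.

(* A C^1 retraction TM -> M, C^1 being read in the charts
   (u, a) |-> (psi u, d psi u a) of TM. *)
Definition retraction M (Rt : 'rV[R]_n -> 'rV[R]_n -> 'rV[R]_n) : Prop :=
  [/\ (forall x v, M x -> tangent M x v -> M (Rt x v)),
      (forall ch, is_chart M ch ->
         Ck 1 [set p : 'rV[R]_m * 'rV[R]_m | ch_img ch p.1]
           (fun p : 'rV[R]_m * 'rV[R]_m => Rt (ch_inv ch p.1) ('d (ch_inv ch) (p.1) (p.2)))),
      (forall x, M x -> Rt x 0 = x) &
      (forall x v, M x -> tangent M x v ->
         is_derive (0 : R) (1 : R) (fun t : R => Rt x (t *: v)) v)].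

Definition clarke_deriv (h : 'rV[R]_m -> R) (y w : 'rV[R]_m) : \bar R :=
  limf_esup (fun p : 'rV[R]_m * R => ((h (p.1 + p.2 *: w) - h p.1) / p.2)%:E)
    (filter_prod (nbhs y) (0 : R)^'+).

Definition clarke_dir (f : 'rV[R]_n -> R) (ch : chart) x v : \bar R :=
  clarke_deriv (f \o ch_inv ch) (ch_map ch x) ('d (ch_map ch) x v).

(* [clarke_dir] does not depend on the chart chosen at [x]. *)
Definition clarke_stationary M (f : 'rV[R]_n -> R) x : Prop :=
  forall ch, chart_at M x ch ->
    forall d, tangent M x d -> (0%E <= clarke_dir f ch x d)%E.

Definition successful (f : 'rV[R]_n -> R) (Rt : 'rV[R]_n -> 'rV[R]_n -> 'rV[R]_n)
    (gamma : R) x (a : R) d : bool :=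
  f (Rt x (a *: d)) <= f x - gamma * a ^+ 2.

Definition search_dir M g x (db : 'rV[R]_n) : 'rV[R]_n :=
  let p := orthproj (tangent M x) db in
  if p == 0 then 0 else (riem_norm g x p)^-1 *: p.

Definition rds_dd M g (f : 'rV[R]_n -> R)
    (Rt : 'rV[R]_n -> 'rV[R]_n -> 'rV[R]_n)
    (x0 : 'rV[R]_n) (alpha0 gamma gamma1 gamma2 : R)
    (dbar x_ : nat -> 'rV[R]_n) (alpha_ : nat -> R) (d_ : nat -> 'rV[R]_n) : Prop :=
  [/\ x_ 0%N = x0, alpha_ 0%N = alpha0 &
      forall k,
        let s := successful f Rt gamma (x_ k) (alpha_ k) (d_ k) in
        [/\ d_ k = search_dir M g (x_ k) (dbar k),
            x_ k.+1 = (if s then Rt (x_ k) (alpha_ k *: d_ k) else x_ k) &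
            alpha_ k.+1 = (if s then gamma2 else gamma1) * alpha_ k]].

End EmbeddedManifold.

Arguments sphere R n : clear implicits.
Arguments chart R n m : clear implicits.
Arguments metric R n : clear implicits.
Arguments is_chart {R n} m M ch.
Arguments embedded_manifold {R n} m M.
Arguments riemannian_metric {R n} m M g.
Arguments geodesic_choice {R n} m M g geo.
Arguments refining {R n} m M g geo x_ d_ i x.
Arguments retraction {R n} m M Rt.
Arguments clarke_stationary {R n} m M f x.

(* Main.v *)
(* The step sizes tend to 0, because each successful step decreases [f] by
   [gamma * alpha^2] and [f] is bounded below. Let [d] be a unit tangent vector
   at [x*] and [d_k -> d] along unsuccessful iterations. In a chart [phi] with
   inverse [psi], the trial point [R(x_k, alpha_k d_k)] differs from
   [psi (phi x_k + alpha_k dphi d)] by [o(alpha_k)], since both are C^1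
   perturbations of [x_k] with the same first-order term. As [f] is Lipschitz in
   the chart, failure of the sufficient decrease test bounds the Clarke
   quotients along [dphi d] below by [- gamma * alpha_k - o(1)].

   The geometric input is that [dist^*(d_k, d) -> 0] forces
   [dphi_{x_k} d_k -> dphi_{x*} d]. A geodesic ending at [x*] that is short
   stays in a small ball of the chart, where the metric is comparable to the
   coordinate norm and the Christoffel symbols are bounded; so a parallel field
   along it has nearly constant components. *)

Require Import Defs.
From mathcomp Require Import all_boot all_order all_algebra.
From mathcomp Require Import all_classical all_reals all_analysis.
From mathcomp Require Import ring lra.
Import Order.TTheory GRing.Theory Num.Theory.
Import numFieldNormedType.Exports.
Local Open Scope classical_set_scope.
Local Open Scope ring_scope.

Set Implicit Arguments.
Unset Strict Implicit.
Unset Printing Implicit Defensive.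

(** * Strict differentiability of C^1 maps *)

Lemma differentiable_line (R : realType) (V : normedModType R) (q v : V) (t : R) :
  differentiable (fun s : R => q + s *: v) t.
Proof.
have dZ : differentiable (fun s : R => s *: v) t by have [] := is_diff_scalel t v.
exact: (differentiableD (differentiable_cst q t) dZ).
Qed.

Lemma is_derive_line (R : realType) (V : normedModType R) (q v : V) (t : R) :
  is_derive t 1 (fun s : R => q + s *: v) v.
Proof.
have dZ : differentiable (fun s : R => s *: v) t by have [] := is_diff_scalel t v.
apply: DeriveDef; first exact/diff_derivable/differentiable_line.
rewrite deriveE; last exact: differentiable_line.
rewrite (diffD (differentiable_cst q t) dZ).
rewrite diff_cst /= add0r.
by have [_ ->] := is_diff_scalel t v; rewrite scale1r.
Qed.

Lemma is_derive1_diff (R : realType) (V W : normedModType R) (h : V -> W)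
    (c : R -> V) (t : R) (v : V) :
  differentiable h (c t) -> is_derive t 1 c v ->
  is_derive t 1 (h \o c) ('d h (c t) v).
Proof.
move=> dh [/derivable1_diffP dc <-].
have dhc : differentiable (h \o c) t by exact: differentiable_comp.
apply: DeriveDef; first exact: diff_derivable.
by rewrite deriveE // diff_comp //= deriveE.
Qed.

Lemma diff_coord (R : realType) (m n : nat) (A B : 'M[R]_(m, n)) i j :
  'd (fun N : 'M[R]_(m, n) => N i j : R) A B = B i j.
Proof.
have @f : {linear 'M[R]_(m, n) -> R}.
  by exists (fun N : 'M[R]_(_, _) => N i j); do 2![eexists]; do ?[constructor];
     rewrite ?mxE// => ? *; rewrite ?mxE//; move=> ?; rewrite !mxE.
rewrite (_ : (fun _ => _) = f) // diff_lin //; exact: coord_continuous.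
Qed.

Lemma is_derive1_coord (R : realType) (n : nat) (c : R -> 'rV[R]_n) (t : R)
    (v : 'rV[R]_n) (j : 'I_n) :
  is_derive t 1 c v -> is_derive t 1 (fun s => c s 0 j) (v 0 j).
Proof.
move=> dc; have := is_derive1_diff (@differentiable_coord _ _ _ (c t) 0 j) dc.
by rewrite diff_coord.
Qed.

Lemma norm_coord_le (R : realType) (n : nat) (v : 'rV[R]_n) (j : 'I_n) :
  `|v 0 j| <= `|v|.
Proof.
rewrite [leRHS]/Num.norm /= mx_normrE.
exact: (le_bigmax _ (fun ij => `|v ij.1 ij.2|) (0, j)).
Qed.

Lemma norm_rV_le (R : realType) (n : nat) (v : 'rV[R]_n) (r : R) :
  0 <= r -> (forall j, `|v 0 j| <= r) -> `|v| <= r.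
Proof.
move=> r0 vr; rewrite [leLHS]/Num.norm /= mx_normrE.
by apply/bigmax_leP; split=> // -[i j] _ /=; rewrite (ord1 i).
Qed.

Lemma cvg_sumr (R : realType) (V : normedModType R) (I T : Type) (r : seq I)
    (F : set_system T) {FF : Filter F} (f : I -> T -> V) (l : I -> V) :
  (forall i, f i x @[x --> F] --> l i) ->
  \sum_(i <- r) f i x @[x --> F] --> \sum_(i <- r) l i.
Proof. by move=> fl; apply: cvg_big => //; exact: add_continuous. Qed.

(* In a space with finitely many bounded coordinates, continuity of the
   directional derivatives along the frame makes a C^1 map strictly
   differentiable. *)
Section Frame.
Context {R : realType} {V : normedModType R} {I : finType}.
Variables (e : I -> V) (co : I -> V -> R).
Hypothesis coE : forall v, v = \sum_i co i v *: e i.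
Hypothesis co_le : forall i v, `|co i v| <= `|v|.

Lemma diff_frame (W : normedModType R) (h : V -> W) q v :
  differentiable h q -> 'd h q v = \sum_i co i v *: 'D_(e i) h q.
Proof.
move=> dh; rewrite {1}(coE v) linear_sum; apply: eq_bigr => i _.
by rewrite linearZ /= deriveE.
Qed.

Lemma diff_frame_le (W : normedModType R) (h : V -> W) q v :
  differentiable h q -> `|'d h q v| <= (\sum_i `|'D_(e i) h q|) * `|v|.
Proof.
move=> dh; rewrite diff_frame // mulr_suml (le_trans (ler_norm_sum _ _ _)) //.
by apply: ler_sum => i _; rewrite normrZ mulrC ler_wpM2l.
Qed.

(** The intermediate parameter depends on the coordinate [j], since the mean value theorem is not
    exact for vector-valued maps. Increments are therefore estimated coordinate by coordinate and
    reassembled in the sup norm. *)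
Lemma mvt_coord n (h : V -> 'rV[R]_n) q v j :
  (forall t : R, 0 <= t <= 1 -> differentiable h (q + t *: v)) ->
  exists2 t : R, 0 <= t <= 1 & (h (q + v) - h q) 0 j = 'd h (q + t *: v) v 0 j.
Proof.
move=> dh.
pose c (t : R) := q + t *: v.
have dphi (t : R) : 0 <= t <= 1 ->
    is_derive t 1 (fun s => h (c s) 0 j) ('d h (c t) v 0 j).
  move=> t01; apply: is_derive1_coord.
  exact: (is_derive1_diff (dh _ t01) (is_derive_line _ _ _)).
have [||t t01] := @MVT_segment R (fun s => h (c s) 0 j)
    (fun t => 'd h (c t) v 0 j) 0 1 ler01.
- by move=> t /itvP t01; apply: dphi; rewrite !t01.
- apply: derivable_within_continuous => t /itvP t01.
  by have [] := dphi t _ ; rewrite ?t01.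
- rewrite /c scale1r scale0r addr0 subr0 mulr1 => E.
  by exists t; [move: t01; rewrite in_itv | rewrite !mxE E].
Qed.

(** By the mean value theorem, each coordinate of the remainder is that of ['d h] at a point of the
    segment minus ['d h p], applied to [v]. The finitely many frame derivatives are uniformly close
    to their values at [p] on a small ball. *)
Lemma strictly_differentiable n (U : set V) (h : V -> 'rV[R]_n) p (eps : R) :
  open U -> Ck 1 U h -> U p -> 0 < eps ->
  exists2 del : R, 0 < del & forall q v, `|p - q| < del -> `|p - (q + v)| < del ->
    `|h (q + v) - h q - 'd h p v| <= eps * `|v|.
Proof.
move=> Uo [dU cU] Up eps0.
(* The successor keeps [N] positive for an empty frame; [#|I|] errors of size [eps / N] still add up
   to at most [eps]. *)
pose N : R := #|I|.+1%:R.
have N0 : 0 < N by rewrite ltr0n.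
have near_p : \forall x \near p, U x /\
    forall i, `|'D_(e i) h p - 'D_(e i) h x| < eps / N.
  near=> x; split; first by near: x; exact: open_nbhs_nbhs.
  near: x; apply: filter_forall => i.
  have /cvgrPdist_lt := cU (e i) p Up; apply; exact: divr_gt0.
have /nbhs_ballP[del /= del0 hdel] := near_p; exists del => // q v.
rewrite -!/(ball_ _ _ _ _) => hq hqv.
have seg t : 0 <= t <= 1 -> ball p del (q + t *: v).
  move=> /andP[t0 t1]; rewrite -ball_normE /=.
  (* Convexity of the ball: the displacement from [p] is a convex combination of the displacements
     at the two endpoints. *)
  have -> : p - (q + t *: v) = (1 - t) *: (p - q) + t *: (p - (q + v)).
    by rewrite !opprD !addrA; move: (p - q) => a; rewrite scalerBl scale1r scalerBr addrA subrK.
  apply: le_lt_trans (ler_normD _ _) _; rewrite !normrZ !ger0_norm ?subr_ge0 //.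
  have M1 : Num.max `|p - q| `|p - (q + v)| < del by rewrite gt_max hq hqv.
  have : `|p - q| <= Num.max `|p - q| `|p - (q + v)| by rewrite le_max lexx.
  have : `|p - (q + v)| <= Num.max `|p - q| `|p - (q + v)| by rewrite le_max lexx orbT.
  by move=> *; nra.
apply: norm_rV_le => [|j]; first by rewrite mulr_ge0 // ltW.
have [t t01 E] := @mvt_coord n h q v j (fun t t01 => dU _ (hdel _ (seg t t01)).1).
have [Ut dt] := hdel _ (seg t t01).
have -> : (h (q + v) - h q - 'd h p v) 0 j = ('d h (q + t *: v) v - 'd h p v) 0 j.
  by rewrite mxE E [RHS]mxE.
rewrite !diff_frame //; try exact: dU.
rewrite -sumrB summxE.
apply: le_trans (ler_norm_sum _ _ _) _.
apply: (@le_trans _ _ (\sum_(i : I) eps / N * `|v|)).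
  apply: ler_sum => i _; rewrite -scalerBr mxE normrM mulrC ler_pM //.
  by apply: le_trans (norm_coord_le _ _) _; rewrite distrC ltW.
rewrite sumr_const -mulr_natr mulrAC ler_wpM2r // -mulrA ger_pMr //.
by rewrite mulrC ler_pdivrMr // mul1r ler_nat.
Unshelve. all: by end_near. Qed.

Lemma C1_locally_lipschitz n (U : set V) (h : V -> 'rV[R]_n) p :
  open U -> Ck 1 U h -> U p ->
  exists2 K : R, 0 <= K & \forall q \near p & q' \near p,
    `|h q' - h q| <= K * `|q' - q|.
Proof.
move=> Uo hU Up.
have [del del0 hdel] := strictly_differentiable Uo hU Up ltr01.
exists (1 + \sum_i `|'D_(e i) h p|); first by rewrite addr_ge0 // sumr_ge0.
have near_p : \forall q \near p, `|p - q| < del.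
  by apply/nbhs_ballP; exists del => //= q; rewrite -ball_normE.
near=> q q'.
have := hdel q (q' - q); rewrite subrKC.
have h1 : `|p - q| < del by near: q.
have h2 : `|p - q'| < del by near: q'.
move=> /(_ h1 h2) H1.
have H2 := diff_frame_le (q' - q) (hU.1 _ Up).
by rewrite -[h q' - h q](subrK ('d h p (q' - q))) mulrDl (le_trans (ler_normD _ _)) // lerD.
Unshelve. all: by end_near. Qed.

(** Joint continuity of the differential in base point and vector: ['d h (q_ x) - 'd h p] is small
    in operator norm on the bounded vectors [v_ x], and ['d h p] is continuous. *)
Lemma C1_cvg_diff n (U : set V) (h : V -> 'rV[R]_n) p v
    (T : Type) (F : set_system T) {FF : Filter F} (q_ v_ : T -> V) :
  open U -> Ck 1 U h -> U p -> q_ x @[x --> F] --> p -> v_ x @[x --> F] --> v ->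
  'd h (q_ x) (v_ x) @[x --> F] --> 'd h p v.
Proof.
move=> Uo [dU cU] Up qp vv.
have H1 : \sum_i `|'D_(e i) h (q_ x) - 'D_(e i) h p| * `|v_ x| @[x --> F] --> (0 : R).
  rewrite -[X in _ --> X](_ : \sum_(i : I) (0 * `|v|) = 0); last first.
    by rewrite big1 // => i _; rewrite mul0r.
  apply: cvg_sumr => i; apply: cvgM; last exact: cvg_norm.
  rewrite -[0](normr0 'rV[R]_n) -(subrr ('D_(e i) h p)); apply: cvg_norm.
  apply: cvgB; last exact: cvg_cst.
  exact: cvg_comp qp (cU (e i) p Up).
have H2 : 'd h p (v_ x) @[x --> F] --> 'd h p v.
  apply: cvg_comp vv _; exact: (@diff_continuous _ _ _ _ h (dU _ Up) v).
rewrite (_ : (fun x => _) =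
    (fun x => ('d h (q_ x) (v_ x) - 'd h p (v_ x)) + 'd h p (v_ x))); last first.
  by apply/funext => x; rewrite subrK.
rewrite -[X in _ --> X]add0r; apply: cvgD H2.
apply/norm_cvg0P.
apply: (@squeeze_cvgr _ _ _ _ (cst 0)); [ |exact: cvg_cst|exact: H1].
have : \forall x \near F, U (q_ x) by apply: qp; exact: open_nbhs_nbhs.
apply: filterS => x Uq; rewrite normr_ge0 /= !diff_frame; try exact: dU.
rewrite -sumrB (le_trans (ler_norm_sum _ _ _)) //; apply: ler_sum => i _.
by rewrite -scalerBr normrZ mulrC ler_wpM2l.
Qed.

(** The base points [q_ k] move together with the steps, so the uniformity in the base point given
    by strict differentiability is what makes the quotients converge. *)
Lemma C1_cvg_quotient n (U : set V) (h : V -> 'rV[R]_n) p v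
    (q_ v_ : nat -> V) (t_ : nat -> R) :
  open U -> Ck 1 U h -> U p -> q_ k @[k --> \oo] --> p -> v_ k @[k --> \oo] --> v ->
  (forall k, 0 < t_ k) -> t_ k @[k --> \oo] --> (0 : R) ->
  (t_ k)^-1 *: (h (q_ k + t_ k *: v_ k) - h (q_ k)) @[k --> \oo] --> 'd h p v.
Proof.
move=> Uo hU Up qp vv t0 t_0.
have H2 : 'd h p (v_ k) @[k --> \oo] --> 'd h p v.
  apply: cvg_comp vv _; exact: (@diff_continuous _ _ _ _ h (hU.1 _ Up) v).
rewrite (_ : (fun x => _) =
    (fun k => ((t_ k)^-1 *: (h (q_ k + t_ k *: v_ k) - h (q_ k)) - 'd h p (v_ k))
              + 'd h p (v_ k))); last first.
  by apply/funext => x; rewrite subrK.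
rewrite -[X in _ --> X]add0r; apply: cvgD H2.
apply/cvgr0Pnorm_le => eps eps0.
have v1 : 0 < `|v| + 1 by rewrite ltr_wpDl.
(* The tolerance is divided by [|v| + 1], which eventually dominates [|v_ k|]. *)
have [del del0 hdel] := strictly_differentiable Uo hU Up (divr_gt0 eps0 v1).
have qv : q_ k + t_ k *: v_ k @[k --> \oo] --> p.
  by rewrite -[X in _ --> X]addr0 -(scale0r v); apply: cvgD qp _; exact: cvgZ.
near=> k.
have vk : `|v_ k| <= `|v| + 1.
  near: k; apply: (cvgr_norm_le _ vv).
  by rewrite ltrDl.
have /= := hdel (q_ k) (t_ k *: v_ k).
have H3 : `|p - q_ k| < del by near: k; move/cvgrPdist_lt : qp; apply.
have H4 : `|p - (q_ k + t_ k *: v_ k)| < del by near: k; move/cvgrPdist_lt : qv; apply.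
move=> /(_ H3 H4); rewrite linearZ /= => H; apply: (@le_trans _ _ (eps / (`|v| + 1) * `|v_ k|)).
  rewrite -(ler_pM2l (t0 k)) -[X in X * `|_ - _|](gtr0_norm (t0 k)) -normrZ scalerBr.
  rewrite scalerKV ?lt0r_neq0 //; apply: le_trans H _.
  by rewrite normrZ gtr0_norm // mulrCA.
by rewrite mulrAC ler_pdivrMr // ler_pM2l.
Unshelve. all: by end_near. Qed.

End Frame.

Lemma row_frameE (R : realType) N (v : 'rV[R]_N) :
  v = \sum_i v 0 i *: (delta_mx 0 i : 'rV[R]_N).
Proof. exact: row_sum_delta. Qed.

(** Charts of the tangent bundle are modelled on a product, so the retraction calls for a frame on
    pairs of row vectors. *)
Definition pair_frame (R : realType) (N P : nat) (i : 'I_N + 'I_P) : 'rV[R]_N * 'rV[R]_P :=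
  match i with inl i => (delta_mx 0 i, 0) | inr i => (0, delta_mx 0 i) end.

Definition pair_coord (R : realType) (N P : nat) (i : 'I_N + 'I_P)
    (v : 'rV[R]_N * 'rV[R]_P) : R :=
  match i with inl i => v.1 0 i | inr i => v.2 0 i end.

Lemma pair_frameE (R : realType) (N P : nat) (v : 'rV[R]_N * 'rV[R]_P) :
  v = \sum_i pair_coord i v *: pair_frame R i.
Proof.
rewrite big_sumType /=; case: v => v w /=.
have fstD : {morph @fst 'rV[R]_N 'rV[R]_P : x y / x + y} by [].
have sndD : {morph @snd 'rV[R]_N 'rV[R]_P : x y / x + y} by [].
rewrite [RHS]surjective_pairing fstD sndD.
rewrite !(big_morph _ fstD erefl) !(big_morph _ sndD erefl) /=.
congr pair.
- rewrite [X in _ = _ + X]big1 ?addr0 => [|i _]; last exact: scaler0.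
  exact: row_sum_delta.
- rewrite [X in _ = X + _]big1 ?add0r => [|i _]; last exact: scaler0.
  exact: row_sum_delta.
Qed.

Lemma pair_coord_le (R : realType) (N P : nat) i (v : 'rV[R]_N * 'rV[R]_P) :
  `|pair_coord i v| <= `|v|.
Proof.
rewrite prod_normE le_max.
by case: i => i /=; rewrite norm_coord_le ?orbT.
Qed.

Section RowFrame.
Context {R : realType} {N n : nat}.
Variables (U : set 'rV[R]_N) (h : 'rV[R]_N -> 'rV[R]_n) (p : 'rV[R]_N).
Hypotheses (Uo : open U) (hU : Ck 1 U h) (Up : U p).

Lemma row_C1_locally_lipschitz :
  exists2 K : R, 0 <= K & \forall q \near p & q' \near p,
    `|h q' - h q| <= K * `|q' - q|.
Proof.
exact: (@C1_locally_lipschitz R 'rV[R]_N _ _ (fun i (v : 'rV[R]_N) => v 0 i) (@row_frameE R N)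
  (fun i v => norm_coord_le v i) _ _ _ _ Uo hU Up).

Qed.

Lemma row_C1_cvg_diff v (T : Type) (F : set_system T) {FF : Filter F}
    (q_ v_ : T -> 'rV[R]_N) :
  q_ x @[x --> F] --> p -> v_ x @[x --> F] --> v ->
  'd h (q_ x) (v_ x) @[x --> F] --> 'd h p v.
Proof.
exact: (@C1_cvg_diff R 'rV[R]_N _ _ (fun i (v : 'rV[R]_N) => v 0 i) (@row_frameE R N)
  (fun i v => norm_coord_le v i) _ _ _ _ _ _ _ _ _ _ Uo hU Up).
Qed.

Lemma row_C1_cvg_quotient v (q_ v_ : nat -> 'rV[R]_N) (t_ : nat -> R) :
  q_ k @[k --> \oo] --> p -> v_ k @[k --> \oo] --> v ->
  (forall k, 0 < t_ k) -> t_ k @[k --> \oo] --> (0 : R) ->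
  (t_ k)^-1 *: (h (q_ k + t_ k *: v_ k) - h (q_ k)) @[k --> \oo] --> 'd h p v.
Proof.
exact: (@C1_cvg_quotient R 'rV[R]_N _ _ (fun i (v : 'rV[R]_N) => v 0 i) (@row_frameE R N)
  (fun i v => norm_coord_le v i) _ _ _ _ _ _ _ _ Uo hU Up).
Qed.

End RowFrame.

Lemma pair_C1_cvg_quotient (R : realType) (N P n : nat)
    (U : set ('rV[R]_N * 'rV[R]_P)) (h : 'rV[R]_N * 'rV[R]_P -> 'rV[R]_n) p v
    (q_ v_ : nat -> 'rV[R]_N * 'rV[R]_P) (t_ : nat -> R) :
  open U -> Ck 1 U h -> U p -> q_ k @[k --> \oo] --> p -> v_ k @[k --> \oo] --> v ->
  (forall k, 0 < t_ k) -> t_ k @[k --> \oo] --> (0 : R) ->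
  (t_ k)^-1 *: (h (q_ k + t_ k *: v_ k) - h (q_ k)) @[k --> \oo] --> 'd h p v.
Proof.
exact: (@C1_cvg_quotient R _ _ _ (@pair_coord R N P) (@pair_frameE R N P)
  (@pair_coord_le R N P)).
Qed.

(** * Charts and tangent spaces *)

Lemma Ck_leq (R : realType) (V W : normedModType R) (U : set V) (h : V -> W) k :
  Ck k.+1 U h -> Ck k U h.
Proof.
elim: k h => [|k IH] h /= [dh ch].
  by move=> x Ux; apply: differentiable_continuous; exact: dh.
by split=> // v; apply: IH; exact: ch.
Qed.

Section Chart.
Context {R : realType} {n m : nat}.
Implicit Types (M : set 'rV[R]_n) (x v w : 'rV[R]_n) (ch : chart R n m).
Local Notation phi ch := (ch_map ch).
Local Notation psi ch := (ch_inv ch).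

Lemma chart_map_C1 M ch : is_chart m M ch -> Ck 1 (ch_dom ch) (phi ch).
Proof. by case. Qed.

Lemma chart_inv_C1 M ch : is_chart m M ch -> Ck 1 (ch_img ch) (psi ch).
Proof. by case. Qed.

(** The curve witnessing tangency is the image under [psi] of the coordinate line through [u] in
    direction [a]. *)
Lemma chart_tangent M ch u a :
  is_chart m M ch -> ch_img ch u -> tangent M (psi ch u) ('d (psi ch) u a).
Proof.
move=> hch Uu; have [[od oi] _ _ _ Mi] := hch.
exists (fun t : R => psi ch (u + t *: a)); split; first by rewrite scale0r addr0.
- have : \forall t \near (0 : R), ch_img ch (u + t *: a).
    have c0 : (fun t : R => u + t *: a) @ (0 : R) --> u.
      rewrite -[X in _ --> X]addr0 -[X in _ + X](scale0r a).
      by apply: cvgD; [exact: cvg_cst|apply: cvgZr_tmp].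
    by apply: c0; exact: open_nbhs_nbhs.
  by apply: filterS => t /Mi[].
- have dl := is_derive_line u a 0.
  have E : u + 0 *: a = u by rewrite scale0r addr0.
  have d1 : differentiable (psi ch) (u + 0 *: a).
    by rewrite E; apply: (chart_inv_C1 hch).1.
  by have := is_derive1_diff d1 dl; rewrite E.
Qed.

Lemma chart_diff_mapK M ch u a :
  is_chart m M ch -> ch_img ch u -> 'd (phi ch) (psi ch u) ('d (psi ch) u a) = a.
Proof.
move=> hch Uu; have [[od oi] _ _ _ Mi] := hch; have [Mu du _] := Mi u Uu.
rewrite -[LHS]/(('d (phi ch) (psi ch u) \o 'd (psi ch) u) a).
have d1 := (chart_inv_C1 hch).1 _ Uu.
have d2 := (chart_map_C1 hch).1 _ du.
rewrite -(diff_comp d1 d2).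
rewrite -deriveE; last exact: differentiable_comp.
rewrite (near_eq_derive (g := id)).
  by rewrite derive_id.
near=> z; have Uz : ch_img ch z by near: z; exact: open_nbhs_nbhs.
by have [] := Mi z Uz.
Unshelve. all: by end_near. Qed.

(** [psi \o phi] is the identity only on [M], not on an open subset of the ambient space. The
    identity is therefore differentiated along a curve of [M] with velocity [v], which is where
    tangency is used. *)
Lemma chart_diff_invK M ch x v :
  is_chart m M ch -> M x -> ch_dom ch x -> tangent M x v ->
  'd (psi ch) (phi ch x) ('d (phi ch) x v) = v.
Proof.
move=> hch Mx dx [c [c0 cM dc]]; have [[od oi] _ _ Md Mi] := hch.
have [Ux phiK] := Md x Mx dx.
have d1 := (chart_map_C1 hch).1 _ dx.
have d2 := (chart_inv_C1 hch).1 _ Ux.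
have dcc : is_derive (0 : R) (1 : R) (psi ch \o (phi ch \o c))
    ('d (psi ch) (phi ch x) ('d (phi ch) x v)).
  rewrite -c0 in d1 d2 *.
  by apply: is_derive1_diff => //; exact: is_derive1_diff.
have <- : 'D_1 (psi ch \o (phi ch \o c)) 0 = 'd (psi ch) (phi ch x) ('d (phi ch) x v).
  by have [] := dcc.
have <- : 'D_1 c 0 = v by have [] := dc.
apply: near_eq_derive.
have cc : {for 0, continuous c}.
  by apply/differentiable_continuous/derivable1_diffP; have [] := dc.
have : \forall t \near (0 : R), ch_dom ch (c t).
  by apply: cc; rewrite c0; exact: open_nbhs_nbhs.
move: cM; apply: filterS2 => t Mc dct /=.
by have [] := Md (c t) Mc dct.
Qed.

End Chart.

(** * The metric and the Christoffel symbols in a chart *)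

Lemma near_bounded_family (R : realType) (V : topologicalType) (I : finType)
    (F : I -> V -> R) (y : V) :
  (forall i, {for y, continuous (F i)}) ->
  exists2 K : R, 0 <= K & \forall u \near y, forall i, `|F i u| <= K.
Proof.
move=> cF; exists (\sum_i (`|F i y| + 1)); first by apply: sumr_ge0 => i _; rewrite addr_ge0.
apply: filter_forall => i.
have : \forall u \near y, `|F i u| <= `|F i y| + 1.
  by apply: (cvgr_norm_le _ (cF i)); rewrite ltrDl.
apply: filterS => u /le_trans; apply.
rewrite (bigD1 i) //= lerDl; apply: sumr_ge0 => j _; by rewrite addr_ge0.
Qed.

(** Linearity is taken as an equation because the metric is a bare function, known to be linear only
    on tangent vectors. *)
Lemma linear_form_coord (R : realType) N (L : 'rV[R]_N -> R) :
  (forall c a b, L (c *: a + b) = c * L a + L b) ->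
  forall a, L a = \sum_i a 0 i * L (delta_mx 0 i).
Proof.
move=> LL a; rewrite {1}(row_frameE a).
have L0 : L 0 = 0.
  by have := LL 1 0 0; rewrite scaler0 addr0 mul1r => /esym/eqP; rewrite -subr_eq0 addrK => /eqP.
elim: (index_enum _) => [|i r IH]; first by rewrite !big_nil.
by rewrite !big_cons LL IH.
Qed.

Section Gram.
Context {R : realType} {n m : nat}.
Variables (M : set 'rV[R]_n) (g : metric R n) (ch : chart R n m).
Hypotheses (hg : riemannian_metric m M g) (hch : is_chart m M ch).
Local Notation phi := (ch_map ch).
Local Notation psi := (ch_inv ch).

Definition gram_form (u a b : 'rV[R]_m) : R :=
  \sum_i \sum_j a 0 i * b 0 j * gram g ch u i j.

(** Composing with ['d psi u] lands in the tangent space, so both slots of the metric become linear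
    forms on all of ['rV_m] and expand along the standard basis. *)
Lemma metric_gram u a b : ch_img ch u ->
  g (psi u) ('d psi u a) ('d psi u b) = gram_form u a b.
Proof.
move=> Uu; have [glin gsym _ _] := hg.
have [_ _ _ _ Mi] := hch; have [Mu _ _] := Mi u Uu.
have T c := chart_tangent c hch Uu.
have lin1 b' c a1 a2 : g (psi u) ('d psi u (c *: a1 + a2)) ('d psi u b') =
    c * g (psi u) ('d psi u a1) ('d psi u b') + g (psi u) ('d psi u a2) ('d psi u b').
  by rewrite linearD linearZ /= glin.
rewrite (linear_form_coord (lin1 b)); apply: eq_bigr => i _.
rewrite gsym // (@linear_form_coord _ _
    (fun b => g (psi u) ('d psi u b) ('d psi u (delta_mx 0 i)))); last first.
  by move=> *; exact: lin1.
rewrite mulr_sumr; apply: eq_bigr => j _.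
by rewrite mxE gsym // mulrA.
Qed.

Lemma metric_chart x v w : M x -> ch_dom ch x -> tangent M x v -> tangent M x w ->
  g x v w = gram_form (phi x) ('d phi x v) ('d phi x w).
Proof.
move=> Mx dx Tv Tw; have [_ _ _ Md _] := hch; have [Ux xK] := Md x Mx dx.
by rewrite -metric_gram // xK !(chart_diff_invK hch).
Qed.

Lemma gram_continuous u i j : ch_img ch u ->
  {for u, continuous (fun z => gram g ch z i j)}.
Proof.
by move=> Uu; have [_ _ _ /(_ ch hch i j 0%N) /(_ u Uu)] := hg.
Qed.

Lemma gram_derive_continuous u v i j : ch_img ch u ->
  {for u, continuous ('D_v (fun z => (gram g ch z i j : R^o)))}.
Proof.
by move=> Uu; have [_ _ _ /(_ ch hch i j 1%N) [_ /(_ v u Uu)]] := hg.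
Qed.

Lemma gram_form_diff_le u v a (d : R) :
  (forall i j, `|gram g ch u i j - gram g ch v i j| <= d) ->
  `|gram_form u a a - gram_form v a a| <= (m * m)%:R * d * `|a| ^+ 2.
Proof.
move=> hd; rewrite /gram_form -sumrB (le_trans (ler_norm_sum _ _ _)) //.
have -> : (m * m)%:R * d * `|a| ^+ 2 = \sum_(i < m) \sum_(j < m) d * `|a| ^+ 2.
  by rewrite !sumr_const !card_ord -mulrnA -mulrA mulr_natl ?[d * _]mulrC ?[K * _]mulrC.
apply: ler_sum => i _; rewrite -sumrB (le_trans (ler_norm_sum _ _ _)) //.
apply: ler_sum => j _; rewrite -mulrBr normrM mulrC ler_pM //.
by rewrite normrM expr2 ler_pM // norm_coord_le.
Qed.

Lemma gram_form_le u a (K : R) : (forall i j, `|gram g ch u i j| <= K) ->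
  gram_form u a a <= (m * m)%:R * K * `|a| ^+ 2.
Proof.
move=> hK.
have -> : (m * m)%:R * K * `|a| ^+ 2 = \sum_(i < m) \sum_(j < m) `|a| ^+ 2 * K.
  by rewrite !sumr_const !card_ord -mulrnA -mulrA mulr_natl ?[d * _]mulrC ?[K * _]mulrC.
apply: ler_sum => i _; apply: ler_sum => j _.
apply: le_trans (ler_norm _) _; rewrite !normrM ler_pM //.
by rewrite expr2 ler_pM // norm_coord_le.
Qed.

Lemma gram_form_scale u (t : R) a :
  gram_form u (t *: a) (t *: a) = t ^+ 2 * gram_form u a a.
Proof.
rewrite /gram_form mulr_sumr; apply: eq_bigr => i _.
rewrite mulr_sumr; apply: eq_bigr => j _; rewrite !mxE; ring.
Qed.

Lemma gram_form_pos u a : ch_img ch u -> a != 0 -> 0 < gram_form u a a.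
Proof.
move=> Uu a0; rewrite -metric_gram //; have [_ _ gpos _] := hg.
have [_ _ _ _ Mi] := hch; have [Mu _ _] := Mi u Uu.
apply: gpos => //; first exact: chart_tangent.
apply: contra_neq a0 => d0.
by rewrite -(chart_diff_mapK a hch Uu) d0 linear0.
Qed.

(** The constant is the minimum of the continuous positive form on the compact sup-norm unit sphere;
    homogeneity extends the bound to all vectors. *)
Lemma gram_form_coercive_at u : ch_img ch u ->
  exists2 kappa : R, 0 < kappa & forall a, kappa * `|a| ^+ 2 <= gram_form u a a.
Proof.
move=> Uu; pose S : set 'rV[R]_m := [set a | `|a| = 1].
have unitS a : a != 0 -> S (`|a|^-1 *: a).
  by move=> a0; rewrite /S /= normrZ normfV normr_id mulVf // normr_eq0.
(* The sphere is empty when [m = 0]; then every vector is zero and any constant serves. *)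
have [S0|/existsNP[c0 /contrapT Sc0]] := pselect (forall a, ~ S a).
  exists 1 => // a; have [->|a0] := eqVneq a 0; last by case: (S0 _ (unitS _ a0)).
  by rewrite normr0 expr0n mulr0 -[X in gram_form _ X X](scale0r 0) gram_form_scale expr0n mul0r.
have cS : compact S.
  apply: bounded_closed_compact.
    by exists 1; split => // x x1 a /= ->; exact: ltW.
  apply: (@preimage_closed _ _ (fun a : 'rV[R]_m => `|a|) [set 1]).
    by move=> a _; exact: norm_continuous.
  exact: closed_eq.
have cQ : continuous (fun a => gram_form u a a).
  move=> a.
  apply: (@cvg_sumr R R^o _ _ _ (nbhs a) _
    (fun i z => \sum_j z 0 i * z 0 j * gram g ch u i j)) => i.
  apply: (@cvg_sumr R R^o _ _ _ (nbhs a) _ (fun j z => z 0 i * z 0 j * gram g ch u i j)) => j.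
  apply: (@cvgM R _ (nbhs a) _ (fun z : 'rV[R]_m => z 0 i * z 0 j)); last exact: cvg_cst.
  by apply: (@cvgM R _ (nbhs a) _ (fun z : 'rV[R]_m => z 0 i)); exact: coord_continuous.
have [c + hc] := @EVT_min_rV R m (fun a => gram_form u a a) S (ex_intro _ c0 Sc0) cS
   (continuous_subspaceT cQ).
rewrite inE => Sc.
exists (gram_form u c c).
  by apply: gram_form_pos => //; rewrite -normr_eq0 Sc oner_eq0.
move=> a; have [->|a0] := eqVneq a 0.
  by rewrite normr0 expr0n mulr0 -[X in gram_form _ X X](scale0r 0) gram_form_scale expr0n mul0r.
have /= := hc _ (mem_set (unitS _ a0)); rewrite gram_form_scale exprVn.
by rewrite ler_pdivlMl ?exprn_gt0 ?normr_gt0 // mulrC.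
Qed.

(** Half of the constant at [y] survives nearby: small changes of the Gram entries perturb the form
    by at most [k / 2] times the squared norm. *)
Lemma gram_form_coercive y : ch_img ch y ->
  exists2 kappa : R, 0 < kappa & \forall u \near y, forall a,
    kappa * `|a| ^+ 2 <= gram_form u a a.
Proof.
move=> Uy; have [k k0 hk] := gram_form_coercive_at Uy.
exists (k / 2); first exact: divr_gt0.
pose N : R := (m * m).+1%:R.
have N0 : 0 < N by rewrite ltr0n.
have d0 : 0 < k / 2 / N by rewrite !divr_gt0.
have : \forall u \near y, forall i j, `|gram g ch u i j - gram g ch y i j| <= k / 2 / N.
  apply: (@filter_forall _ _
    (fun i u => forall j, `|gram g ch u i j - gram g ch y i j| <= k / 2 / N) (nbhs y)) => i.
  apply: (@filter_forall _ _
    (fun j u => `|gram g ch u i j - gram g ch y i j| <= k / 2 / N) (nbhs y)) => j.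
  have /cvgrPdist_le /(_ _ d0) := @gram_continuous y i j Uy.
  apply: filterS => u hu.
  rewrite distrC.
  exact: hu.
apply: filterS => u hu a.
have := gram_form_diff_le a hu; rewrite ler_norml => /andP[h _].
have : (m * m)%:R * (k / 2 / N) * `|a| ^+ 2 <= k / 2 * `|a| ^+ 2.
  rewrite ler_wpM2r ?exprn_ge0 // mulrA ler_pdivrMr // mulrC ler_pM2l ?divr_gt0 //.
  by rewrite ler_nat.
have := hk a; move: h.
by move: (gram_form _ _ _) (gram_form _ _ _) (_ * _ * _) => *; lra.
Qed.

(** Let [a] be column [l] of the inverse [X]. Then the form at [a] equals [X l l], which is at most
    [|a|], so coercivity gives [kappa * |a|^2 <= |a|] and hence [|a| <= kappa^-1]. *)
Lemma invmx_gram_le u (kappa K : R) k l : 0 < kappa -> 0 <= K ->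
  (forall a, kappa * `|a| ^+ 2 <= gram_form u a a) ->
  (forall i j, `|gram g ch u i j| <= K) ->
  `|invmx (gram g ch u) k l| <= kappa^-1 + K.
Proof.
move=> k0 K0 hk hK.
(* [invmx] of a singular matrix is the matrix itself; the summand [K] of the bound covers this
   case. *)
have [Gu|Gu] := boolP (gram g ch u \in unitmx); last first.
  rewrite invmx_out // (le_trans (hK _ _)) // lerDr invr_ge0; exact: ltW.
rewrite ler_wpDr //.
set X := invmx _; pose a : 'rV[R]_m := \row_i X i l.
have Ea : gram_form u a a = X l l.
  have : (gram g ch u *m X) = 1%:M by rewrite mulmxV.
  move=> GX; rewrite /gram_form.
  transitivity (\sum_i X i l * (gram g ch u *m X) i l).
    apply: eq_bigr => i _; rewrite [in RHS]mxE mulr_sumr; apply: eq_bigr => j _.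
    by rewrite !mxE; ring.
  rewrite GX (bigD1 l) //= mxE eqxx mulr1 big1 ?addr0 // => i il.
  by rewrite mxE (negbTE il) mulr0.
have al : `|a 0 k| <= `|a| by exact: norm_coord_le.
have ll : `|a 0 l| <= `|a| by exact: norm_coord_le.
have := hk a; rewrite Ea; rewrite !mxE in al ll.
move=> h; apply: le_trans al _.
have {}h : kappa * `|a| ^+ 2 <= `|a| by apply: le_trans h (le_trans (ler_norm _) ll).
have [->|a0] := eqVneq `|a| 0; first by rewrite invr_ge0 ltW.
have {}a0 : 0 < `|a| by rewrite lt_neqAle eq_sym a0 /=.
rewrite -[kappa^-1]mulr1 ler_pdivlMl //.
by rewrite -(ler_pM2r a0) mul1r -mulrA.
Qed.

(** One neighbourhood with uniform constants: the upper bound on the Gram entries controls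
    distances, coercivity controls coordinate velocities, and the Christoffel bound controls
    parallel fields. *)
Lemma gram_bounds y : ch_img ch y -> exists kappa K : R,
  [/\ 0 < kappa, 0 <= K &
   \forall u \near y, [/\ ch_img ch u, forall i j, `|gram g ch u i j| <= K,
     forall k i j, `|christoffel g ch u k i j| <= K &
     forall a, kappa * `|a| ^+ 2 <= gram_form u a a]].
Proof.
move=> Uy; have [k k0 hk] := gram_form_coercive Uy.
have [K1 K10 hK1] := @near_bounded_family R _ ('I_m * 'I_m)%type
  (fun ij u => gram g ch u ij.1 ij.2) y (fun ij => @gram_continuous y _ _ Uy).
have [K2 K20 hK2] := @near_bounded_family R _ ('I_m * 'I_m * 'I_m)%type
  (fun ij => 'D_(delta_mx 0 ij.1.1) (fun z => (gram g ch z ij.1.2 ij.2 : R^o))) y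
  (fun ij => @gram_derive_continuous y _ _ _ Uy).
(* A Christoffel symbol is half of a sum of [m] products of an inverse Gram entry, at most
   [k^-1 + K1], with three first derivatives, each at most [K2]. *)
pose K3 : R := 2^-1 * (m%:R * ((k^-1 + K1) * (3 * K2))).
have K30 : 0 <= K3.
  by rewrite !mulr_ge0 // ?invr_ge0 // addr_ge0 // invr_ge0 ltW.
exists k, (K1 + K3); split; rewrite ?addr_ge0 //.
near=> u.
have hu : forall i j, `|gram g ch u i j| <= K1.
  have hu : forall ij : 'I_m * 'I_m, `|gram g ch u ij.1 ij.2| <= K1 by near: u.
  by move=> i j; exact: (hu (i, j)).
have hu2 : forall l i j, `|'D_(delta_mx 0 l) (fun z => (gram g ch z i j : R^o)) u| <= K2.
  have hu2 : forall ij : 'I_m * 'I_m * 'I_m,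
    `|'D_(delta_mx 0 ij.1.1) (fun z => (gram g ch z ij.1.2 ij.2 : R^o)) u| <= K2 by near: u.
  by move=> l i j; exact: (hu2 (l, i, j)).
have hku : forall a, k * `|a| ^+ 2 <= gram_form u a a by near: u.
split => //.
- by near: u; apply: open_nbhs_nbhs; split=> //; case: hch => -[].
- by move=> i j; rewrite (le_trans (hu i j)) // lerDl.
move=> c i j; apply: (@le_trans _ _ K3); last by rewrite lerDr.
rewrite /christoffel normrM gtr0_norm ?invr_gt0 // ler_pM2l ?invr_gt0 //.
rewrite (le_trans (ler_norm_sum _ _ _)) //.
have -> : m%:R * ((k^-1 + K1) * (3 * K2)) = \sum_(l < m) ((k^-1 + K1) * (3 * K2)).
  by rewrite sumr_const card_ord mulr_natl.
apply: ler_sum => l _; rewrite normrM ler_pM //; first exact: invmx_gram_le.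
rewrite (le_trans (ler_normB _ _)) //.
have := ler_normD ('D_(ebasis i) (fun z => (gram g ch z j l : R^o)) u)
  ('D_(ebasis j) (fun z => (gram g ch z i l : R^o)) u).
have := hu2 i j l; have := hu2 j i l; have := hu2 l i j.
by rewrite /ebasis => *; lra.
Unshelve. all: by end_near. Qed.

End Gram.

(** * Lengths of curves *)

Lemma unit_nbhd_open (R : realType) (e t : R) : unit_nbhd e t ->
  \forall s \near t, unit_nbhd e s.
Proof.
move=> /andP[t1 t2]; near=> s; apply/andP; split.
  by near: s; exact: lt_nbhsr.
by near: s; exact: lt_nbhsl.
Unshelve. all: by end_near. Qed.

Lemma unit_nbhd_01 (R : realType) (e t : R) : 0 < e -> 0 <= t <= 1 -> unit_nbhd e t.
Proof. by move=> e0 /andP[t0 t1]; apply/andP; split; lra. Qed.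

(** Both [K * s - w] and [K * s + w] are nondecreasing. For [s] only continuity is asked at the
    endpoints, since it will be an arc length function, differentiated only in the interior. *)
Lemma increment_le (R : realType) (s sigma w w' : R -> R) (K a b : R) :
  a <= b ->
  {within `[a, b], continuous s} -> (forall t, a < t < b -> is_derive t 1 s (sigma t)) ->
  (forall t, a <= t <= b -> is_derive t 1 w (w' t)) ->
  (forall t, a < t < b -> `|w' t| <= K * sigma t) ->
  `|w b - w a| <= K * (s b - s a).
Proof.
move=> ab cs ds dw hw.
have cw : {within `[a, b], continuous w}.
  by apply: derivable_within_continuous => t; rewrite in_itv => /dw[].
(* The condition [eps ^+ 2 = 1] treats both signs at once. *)
have key (eps : R) : eps ^+ 2 = 1 -> eps * (w b - w a) <= K * (s b - s a).
  move=> eps2; pose h t := K * s t - eps * w t.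
  have dh t : a < t < b -> is_derive t 1 h (K * sigma t - eps * w' t).
    move=> tab; have d1 := ds t tab.
    have d2 : is_derive t 1 w (w' t) by apply: dw; case/andP: tab => /ltW -> /ltW ->.
    exact: is_deriveB.
  have : h a <= h b.
    have la : a \in `[a, b] by rewrite in_itv /= lexx ab.
    have lb : b \in `[a, b] by rewrite in_itv /= lexx ab.
    apply: (@ger0_derive1_le_cc R h a b _ _ _ a b la lb ab).
    - by move=> t; rewrite in_itv => /dh[].
    - move=> t; rewrite in_itv => tab; rewrite derive1E; have [_ ->] := dh t tab.
      rewrite subr_ge0; apply: le_trans (hw t tab).
      have /eqP : eps ^+ 2 = 1 by []; rewrite sqrf_eq1 => /orP[] /eqP ->.
        by rewrite mul1r ler_norm.
      by rewrite mulN1r -normrN ler_norm.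
    - move=> t; apply: cvgB; first by apply: cvgMr; exact: cs.
      by apply: cvgMr; exact: cw.
  by rewrite /h; lra.
rewrite ler_norml; have := key 1 (expr1n _ _); have := key (-1) (sqrr_sign _ 1).
by move=> *; apply/andP; split; lra.
Qed.

Lemma is_derive_continuous (R : realType) (V : normedModType R) (c : R -> V)
    (t : R) (v : V) : is_derive t 1 c v -> {for t, continuous c}.
Proof. by move=> [dc _]; apply/differentiable_continuous/derivable1_diffP. Qed.

Section Curves.
Context {R : realType} {n m : nat}.
Variables (M : set 'rV[R]_n) (g : metric R n).
Hypotheses (hM : embedded_manifold m M) (hg : riemannian_metric m M g).
Implicit Types c : R -> 'rV[R]_n.

Lemma curve_is_derive e c t : curve_of_class 1 M e c -> unit_nbhd e t ->
  is_derive t 1 c (derive1 c t).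
Proof.
move=> [[dc _] _] et; rewrite derive1E; apply: derivableP.
by apply/derivable1_diffP; exact: (dc t et).
Qed.

Lemma curve_derive_continuous e c t : curve_of_class 1 M e c -> unit_nbhd e t ->
  {for t, continuous (derive1 c)}.
Proof.
move=> [[_ cc] _] et; have -> : derive1 c = 'D_1 c by apply/funext => s; rewrite derive1E.
exact: (cc 1 t et).
Qed.

Lemma curve_tangent e c t : curve_of_class 1 M e c -> unit_nbhd e t ->
  tangent M (c t) (derive1 c t).
Proof.
move=> hc et; have dc := curve_is_derive hc et.
have E : t + 0 *: 1 = t by rewrite scale0r addr0.
exists (fun s => c (t + s *: 1)); split; first by rewrite E.
- have c0 : t + s *: 1 @[s --> (0 : R)] --> t.
    rewrite -[X in _ --> X]E.
    by have /is_derive_continuous := is_derive_line t 1 0.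
  near=> s; apply: hc.2; near: s; exact: (c0 _ (unit_nbhd_open et)).
- have dl := is_derive_line t 1 0.
  have d1 : differentiable c (t + 0 *: 1).
    by rewrite E; apply/derivable1_diffP; have [] := dc.
  have := @is_derive1_diff _ _ _ c (fun s : R => t + s *: 1) 0 1 d1 dl; rewrite E => h.
  rewrite derive1E'; first exact: h.
  by rewrite -E.
Unshelve. all: by end_near. Qed.

(** The metric is regular only through its Gram matrices, so near [t] the speed is rewritten in a
    chart at [c t], where all its ingredients are continuous. *)
Lemma speed_continuous e c t : curve_of_class 1 M e c -> unit_nbhd e t ->
  {for t, continuous (fun s => riem_norm g (c s) (derive1 c s))}.
Proof.
move=> hc et; have Mt := hc.2 t et.
have [ch [hch dt]] := hM Mt.
have [[od oi] _ _ Md _] := hch.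
have ct : c s @[s --> t] --> c t := is_derive_continuous (curve_is_derive hc et).
have cdom : \forall s \near t, ch_dom ch (c s) by apply: ct; exact: open_nbhs_nbhs.
pose u s := ch_map ch (c s); pose u' s := 'd (ch_map ch) (c s) (derive1 c s).
have cu : u s @[s --> t] --> u t.
  apply: cvg_comp ct _.
  exact: (differentiable_continuous ((chart_map_C1 hch).1 _ dt)).
have cu' : u' s @[s --> t] --> u' t.
  apply: (row_C1_cvg_diff od (chart_map_C1 hch) dt ct).
  exact: curve_derive_continuous hc et.
have E : \forall s \near t, Num.sqrt (gram_form g ch (u s) (u' s) (u' s)) =
    riem_norm g (c s) (derive1 c s).
  near=> s.
  have es : unit_nbhd e s by near: s; exact: unit_nbhd_open.
  have Ts := curve_tangent hc es.
  rewrite /riem_norm (metric_chart hg hch _ _ Ts Ts) //; [exact: hc.2|by near: s].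
have H : gram_form g ch (u s) (u' s) (u' s) @[s --> t] --> gram_form g ch (u t) (u' t) (u' t).
  apply: (@cvg_sumr R R^o _ _ _ (nbhs t) _
    (fun i s => \sum_j u' s 0 i * u' s 0 j * gram g ch (u s) i j)) => i.
  apply: (@cvg_sumr R R^o _ _ _ (nbhs t) _
    (fun j s => u' s 0 i * u' s 0 j * gram g ch (u s) i j)) => j.
  have cc (k : 'I_m) : u' s 0 k @[s --> t] --> u' t 0 k.
    apply: (@continuous_cvg R 'rV[R]_m R _ _ u' (fun v : 'rV[R]_m => v 0 k) (u' t)) cu'.
    exact: coord_continuous.
  apply: (@cvgM R _ (nbhs t) _ (fun s => u' s 0 i * u' s 0 j)).
    by apply: (@cvgM R _ (nbhs t) _ (fun s => u' s 0 i)).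
  have Ut : ch_img ch (u t) by have [] := Md _ Mt dt.
  apply: (@continuous_cvg R 'rV[R]_m R _ _ u (fun z => gram g ch z i j) (u t)) cu.
  exact: (@gram_continuous _ _ _ _ _ _ hg hch _ i j Ut).
suff : riem_norm g (c s) (derive1 c s) @[s --> t] --> Num.sqrt (gram_form g ch (u t) (u' t) (u' t)).
  by rewrite (nbhs_singleton E).
have {}H : Num.sqrt (gram_form g ch (u s) (u' s) (u' s)) @[s --> t] -->
    Num.sqrt (gram_form g ch (u t) (u' t) (u' t)) :=
  continuous_cvg (nbhs_filter t) (@sqrt_continuous R _) H.
exact: (cvg_trans (@near_eq_cvg R R (nbhs t) _
  (fun s => Num.sqrt (gram_form g ch (u s) (u' s) (u' s)))
  (fun s => riem_norm g (c s) (derive1 c s)) E) H).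
Unshelve. all: by end_near. Qed.

(** Produces the arc length function against which coordinate motion and parallel fields are
    compared; its derivative is the speed by the fundamental theorem of calculus. *)
Lemma arc_length (e : R) c : 0 < e -> curve_of_class 1 M e c ->
  exists s : R -> R, [/\ s 0 = 0, s 1 = curve_length g c,
    {within `[0, 1], continuous s} &
    forall t : R, 0 < t < 1 -> is_derive t 1 s (riem_norm g (c t) (derive1 c t))].
Proof.
move=> e0 hc; pose sigma t := riem_norm g (c t) (derive1 c t).
have cont : {within `[0, 1], continuous sigma}.
  apply: continuous_in_subspaceT => t /[!inE] /=; rewrite in_itv /= => t01.
  exact/(speed_continuous hc)/unit_nbhd_01.
have isig : (@lebesgue_measure R).-integrable `[0, 1] (EFin \o sigma).
  by apply: continuous_compact_integrable => //; exact: segment_compact.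
exists (fun x => \int[@lebesgue_measure R]_(t in `[0, x]) sigma t); split => //.
- by rewrite set_itv1 Rintegral_set1.
- exact: parameterized_integral_continuous.
- move=> t t01; have ct : {for t, continuous sigma}.
    by apply/(speed_continuous hc)/unit_nbhd_01 => //; case/andP: t01 => /ltW -> /ltW ->.
  case/andP: t01 => t0 t1.
  have [d1 d2] := continuous_FTC1_closed t1 isig t0 ct.
  apply: (DeriveDef d1); rewrite -derive1E; exact: d2.
Qed.

End Curves.

(** * Riemannian distance against the coordinate norm *)

Section ChartSegment.
Context {R : realType} {n m : nat}.
Variables (M : set 'rV[R]_n) (g : metric R n) (ch : chart R n m).
Hypotheses (hM : embedded_manifold m M) (hg : riemannian_metric m M g).
Hypothesis (hch : is_chart m M ch).
Local Notation phi := (ch_map ch).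
Local Notation psi := (ch_inv ch).

Let segment_curve (e : R) u v :
  (forall t, unit_nbhd e t -> ch_img ch (u + t *: v)) ->
  curve_of_class 1 M e (fun t : R => psi (u + t *: v)) /\
  forall t, unit_nbhd e t ->
    derive1 (fun t : R => psi (u + t *: v)) t = 'd psi (u + t *: v) v.
Proof.
move=> hU; have [[od oi] _ _ _ Mi] := hch.
set b := fun t => _; set l := fun t : R => u + t *: v.
have dl (t : R) : is_derive t 1 l v by exact: is_derive_line.
have db (t : R) : unit_nbhd e t -> is_derive t 1 b ('d psi (l t) v).
  move=> et; apply: (@is_derive1_diff _ _ _ psi l t v) => //.
  by apply: (chart_inv_C1 hch).1; exact: hU.
split; last by move=> t et; rewrite derive1E; have [_ ->] := db t et.
split; last by move=> t et; have [] := Mi _ (hU t et).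
have dfb (t : R) : unit_nbhd e t -> differentiable b t.
  by move=> et; apply/derivable1_diffP; have [] := db t et.
split; first exact: dfb.
move=> w t et.
have Dw (s : R) : unit_nbhd e s -> 'D_w b s = w *: 'd psi (l s) v.
  move=> es; rewrite deriveE; last exact: dfb.
  rewrite -[w in LHS]mulr1 -[w * 1]/(w *: (1 : R)) linearZ /=.
  by rewrite -deriveE; [have [_ ->] := db s es|exact: dfb].
have H : w *: 'd psi (l s) v @[s --> t] --> w *: 'd psi (l t) v.
  apply: cvgZl_tmp.
  apply: (@row_C1_cvg_diff R m n _ psi (l t) oi (chart_inv_C1 hch) (hU t et) v R (nbhs t));
    last exact: cvg_cst.
  by have /is_derive_continuous := dl t.
have H2 : 'D_w b s @[s --> t] --> w *: 'd psi (l t) v.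
  apply: cvg_trans H; apply: near_eq_cvg; near=> s.
  by rewrite Dw //; near: s; exact: unit_nbhd_open.
by rewrite -(Dw t et) in H2.
Unshelve. all: by end_near. Qed.

(** The shortest geodesic is no longer than the image of the coordinate segment from [u] to [v],
    whose speed is at most a constant times [|v - u|]. *)
Lemma dist_chart_le geo y : geodesic_choice m M g geo -> ch_img ch y ->
  exists2 K : R, 0 <= K & \forall u \near y & v \near y,
    dist g geo (psi u) (psi v) <= K * `|v - u|.
Proof.
move=> hgeo Uy; have [[od oi] _ _ _ Mi] := hch.
have [k [K [k0 K0 hK]]] := gram_bounds hg hch Uy.
have /nbhs_ballP[r /= r0 hr] := hK.
pose A := Num.sqrt ((m * m)%:R * K).
exists A; first exact: sqrtr_ge0.
(* Competing curves live on a larger interval, here [(-1/2, 3/2)]. With both endpoints within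
   [r / 4] of [y], the extended segment stays within [r / 4 + (3 / 2) * (r / 2) = r]. *)
have r4 : 0 < r / 4 by rewrite divr_gt0.
have Hr u : `|y - u| < r -> [/\ ch_img ch u, forall i j, `|gram g ch u i j| <= K,
     forall k i j, `|christoffel g ch u k i j| <= K &
     forall a, k * `|a| ^+ 2 <= gram_form g ch u a a].
  by move=> yu; apply: hr; rewrite -ball_normE.
have near_r : \forall u \near y, `|y - u| < r / 4.
  by apply/nbhs_ballP; exists (r / 4) => //= u; rewrite -ball_normE.
near=> u v.
have hu : `|y - u| < r / 4 by near: u.
have hv : `|y - v| < r / 4 by near: v.
have hvu : `|v - u| <= r / 2.
  have -> : v - u = (y - u) - (y - v) by rewrite opprB [RHS]addrC subrKA.
  by apply: le_trans (ler_normB _ _) _; lra.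
have seg (t : R) : unit_nbhd 2^-1 t -> `|y - (u + t *: (v - u))| < r.
  move=> /andP[t1 t2]; rewrite opprD addrA (le_lt_trans (ler_normB _ _)) // normrZ.
  have tt : `|t| <= 3 / 2 by rewrite ler_norml; apply/andP; split; lra.
  have := ler_pM (normr_ge0 t) (normr_ge0 (v - u)) tt hvu.
  by move=> *; lra.
have hU (t : R) : unit_nbhd 2^-1 t -> ch_img ch (u + t *: (v - u)).
  by move=> /seg/Hr[].
have [hb db] := segment_curve hU.
have e0 : 0 < 2^-1 :> R by rewrite invr_gt0.
have [s [s0 s1 cs ds]] := arc_length hM hg e0 hb.
have hur : `|y - u| < r by lra.
have hvr : `|y - v| < r by lra.
have Mu : M (psi u) by have [Uu _ _ _] := Hr u hur; have [] := Mi u Uu.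
have Mv : M (psi v) by have [Uv _ _ _] := Hr v hvr; have [] := Mi v Uv.
have [[_ _ _ shortest] _] := hgeo _ _ Mu Mv.
have := shortest _ _ e0 hb; rewrite /= scale0r addr0 scale1r subrKC =>
  /(_ erefl erefl) /le_trans; apply.
pose b (t : R) := psi (u + t *: (v - u)).
have ds' (t : R) : t \in `]0, 1[ -> is_derive t 1 s (riem_norm g (b t) (derive1 b t)).
  by rewrite in_itv; exact: ds.
(* The length equals the speed at some intermediate time, so a pointwise bound on the speed
   suffices. *)
have [x x01] := MVT_segment ler01 ds' cs; rewrite s0 s1 !subr0 mulr1 => ->.
have ex : unit_nbhd 2^-1 x by apply: unit_nbhd_01 => //; move: x01; rewrite in_itv.
have [Ux hK1 _ _] := Hr _ (seg x ex).
rewrite /riem_norm /b (db x ex) (metric_gram hg hch) //.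
apply: (@le_trans _ _ (Num.sqrt ((m * m)%:R * K * `|v - u| ^+ 2))).
  by rewrite ler_wsqrtr // gram_form_le.
rewrite sqrtrM; last by rewrite mulr_ge0.
by rewrite sqrtr_sqr normr_id.
Unshelve. all: by end_near. Qed.

End ChartSegment.

(** * Parallel transport along short curves *)

Section ShortCurve.
Context {R : realType} {n m : nat}.
Variables (M : set 'rV[R]_n) (g : metric R n) (ch : chart R n m).
Hypotheses (hM : embedded_manifold m M) (hg : riemannian_metric m M g).
Hypothesis (hch : is_chart m M ch).
Local Notation phi := (ch_map ch).
Local Notation psi := (ch_inv ch).
Variables (y : 'rV[R]_m) (r kappa K : R).
Hypotheses (r0 : 0 < r) (k0 : 0 < kappa) (K0 : 0 <= K).
Hypothesis bounds : forall u, `|y - u| < r -> [/\ ch_img ch u,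
  forall i j, `|gram g ch u i j| <= K, forall k i j, `|christoffel g ch u k i j| <= K &
  forall a, kappa * `|a| ^+ 2 <= gram_form g ch u a a].
Variables (e : R) (c : R -> 'rV[R]_n).
Hypotheses (e0 : 0 < e) (hc : curve_of_class 1 M e c) (c1 : c 1 = psi y).

Let A : R := (Num.sqrt kappa)^-1.
Let u (t : R) := phi (c t).
Let u' (t : R) := 'd phi (c t) (derive1 c t).
Let sigma (t : R) := riem_norm g (c t) (derive1 c t).
Let inside (t : R) := ch_dom ch (c t) /\ `|y - u t| < r.

Let A0 : 0 <= A. Proof. by rewrite invr_ge0 sqrtr_ge0. Qed.

Let Uy : ch_img ch y.
Proof. by have [] : _ := bounds (u := y) _; rewrite ?subrr ?normr0. Qed.

Let du t : unit_nbhd e t -> ch_dom ch (c t) -> is_derive t 1 u (u' t).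
Proof.
move=> et dt; apply: is_derive1_diff; first exact: (chart_map_C1 hch).1.
exact: curve_is_derive hc et.
Qed.

Let u'_le t : unit_nbhd e t -> inside t -> `|u' t| <= A * sigma t.
Proof.
move=> et [dt ut]; have [_ _ _ hk] := bounds ut.
have Tt := curve_tangent hc et.
have sk : 0 < Num.sqrt kappa by rewrite sqrtr_gt0.
rewrite /sigma /riem_norm (metric_chart hg hch (hc.2 t et) dt Tt Tt) ler_pdivlMl //.
have -> : Num.sqrt kappa * `|u' t| = Num.sqrt (kappa * `|u' t| ^+ 2).
  by rewrite sqrtrM ?ltW // sqrtr_sqr normr_id.
exact/ler_wsqrtr/hk.
Qed.

Variable s : R -> R.
Hypotheses (s0 : s 0 = 0) (cs : {within `[0, 1], continuous s}).
Hypothesis ds : forall t : R, 0 < t < 1 -> is_derive t 1 s (sigma t).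
Hypothesis s1r : A * s 1 < r.

Let s_ge0 (a : R) : 0 <= a <= 1 -> 0 <= s a.
Proof.
move=> /andP[a0 a1].
(* Comparing [s] with a constant function turns the increment inequality into monotonicity of
   [s]. *)
pose z : R -> R := fun=> 0.
have sE : `|z a - z 0| <= 1 * (s a - s 0) -> 0 <= s a.
  by rewrite /z subrr normr0 mul1r s0 subr0.
apply: sE; apply: (@increment_le R s sigma z z 1 0 a a0).
- by apply: (continuous_subspaceW _ cs); apply: subset_itvl; rewrite bnd_simp.
- by move=> t /andP[t0 ta]; apply: ds; rewrite t0 (lt_le_trans ta).
- by move=> t _; rewrite normr0 mul1r sqrtr_ge0.
Qed.

Let u_near (a : R) : 0 <= a <= 1 -> (forall t, a <= t <= 1 -> inside t) ->
  `|y - u a| <= A * s 1.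
Proof.
move=> /andP[a0 a1] ins.
have u1 : u 1 = y by rewrite /u c1; have [_ _ _ _ Mi] := hch; have [] := Mi y Uy.
have sa : 0 <= s a by apply: s_ge0; rewrite a0.
have s10 : 0 <= s 1 by apply: s_ge0; rewrite ler01 lexx.
have et (t : R) : a <= t <= 1 -> unit_nbhd e t.
  by move=> /andP[at_ t1]; apply: unit_nbhd_01 => //; rewrite t1 (le_trans a0).
apply: norm_rV_le => [|j]; first by rewrite mulr_ge0.
rewrite -u1 !mxE.
apply: (@le_trans _ _ (A * (s 1 - s a))); last by rewrite ler_wpM2l // gerBl.
apply: (@increment_le R s sigma (fun t => u t 0 j) (fun t => u' t 0 j)) => //.
- by apply: (continuous_subspaceW _ cs); apply: subset_itvr; rewrite bnd_simp.
- by move=> t /andP[at_ t1]; apply: ds; rewrite t1 (le_lt_trans a0).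
- move=> t at1; apply: is_derive1_coord; apply: du; first exact: et.
  by have [] := ins t at1.
- move=> t /andP[/ltW at_ /ltW t1].
  have at1 : a <= t <= 1 by rewrite at_ t1.
  by apply: le_trans (norm_coord_le _ _) _; apply: u'_le; [exact: et|exact: ins].
Qed.

Let inside_open t : unit_nbhd e t -> inside t -> \forall x \near t, inside x.
Proof.
move=> et [dt ut]; have [[od oi] _ _ _ _] := hch.
have ct : c x @[x --> t] --> c t := is_derive_continuous (curve_is_derive hc et).
have cu : u x @[x --> t] --> u t := is_derive_continuous (du et dt).
near=> x; split; first by near: x; apply: ct; exact: open_nbhs_nbhs.
have : `|y - u x| < r.
  near: x; apply: (cvgr_lt (f := fun x => `|y - u x|) `|y - u t|) => //.
  by apply: cvg_norm; apply: cvgB => //; exact: cvg_cst.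
by [].
Unshelve. all: by end_near. Qed.

(** The chart domain is open, so a limit of curve points could leave it. The image of a closed
    coordinate ball is compact, hence closed in the ambient space, and prevents this. *)
Let image_ball_closed : closed (psi @` [set v | `|y - v| <= A * s 1]).
Proof.
apply: compact_closed; first exact: norm_hausdorff.
apply: continuous_compact.
  apply: continuous_in_subspaceT => v /[!inE] /= hv.
  apply: differentiable_continuous; apply: (chart_inv_C1 hch).1.
  by have [] := bounds (le_lt_trans hv s1r).
apply: bounded_closed_compact.
  exists (`|y| + A * s 1); split; first exact: num_real.
  move=> x xr v /= hv.
  rewrite -[v](subKr y) (le_trans (ler_normB _ _)) // (le_trans _ (ltW xr)) //.
  by rewrite lerD2l.
apply: (@preimage_closed _ _ (fun v : 'rV[R]_m => `|y - v|) [set x | x <= A * s 1]).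
  move=> v _; apply: (@cvg_norm _ _ _ (nbhs v)); apply: cvgB; [exact: cvg_cst|exact: cvg_id].
exact: closed_le.
Qed.

(** Continuation backwards from time 1. Let [tau] be the infimum of the times from which the curve
    stays inside up to 1. Closedness puts [tau] itself inside, with coordinates at distance less
    than [r]; openness then forbids [tau > 0]. *)
Lemma short_curve_inside (t : R) : 0 <= t <= 1 -> inside t.
Proof.
have [_ _ _ _ Mi] := hch.
have ins1 : inside 1.
  rewrite /inside /u c1; have [_ d1 ->] := Mi y Uy.
  by rewrite subrr normr0.
pose B : set R := [set a | 0 <= a <= 1 /\ forall t, a <= t <= 1 -> inside t].
have B1 : B 1.
  split; first by rewrite ler01 lexx.
  by move=> x /andP[x1 x2]; have -> : x = 1 by apply/eqP; rewrite eq_le x1 x2.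
have lB : lbound B 0 by move=> x [/andP[]].
have hlB : has_lbound B by exists 0.
pose tau := inf B.
have tau0 : 0 <= tau by apply: lb_le_inf => //; exists 1.
have tau1 : tau <= 1 by exact: ge_inf.
have after (x : R) : tau < x -> x <= 1 -> B x.
  move=> tx x1; have [|b [/andP[b0 b1] hb] bx] := @inf_lt R B x _ tx; first by exists 1.
  split; first by rewrite x1 (le_trans b0) // ltW.
  by move=> z /andP[xz z1]; apply: hb; rewrite z1 (le_trans (ltW bx)).
have Btau : B tau.
  split; first by rewrite tau0.
  suff ins_tau : inside tau.
    move=> x /andP[]; rewrite le_eqVlt => /orP[/eqP <- //|tx] x1.
    by have [_] := after x tx x1; apply; rewrite lexx.
  have [->//|tau_neq1] := eqVneq tau 1.
  have {tau_neq1} tlt1 : tau < 1 by rewrite lt_neqAle tau_neq1.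
  have etau : unit_nbhd e tau by apply: unit_nbhd_01 => //; rewrite tau0.
  have ctau : c x @[x --> tau] --> c tau := is_derive_continuous (curve_is_derive hc etau).
  (* [c tau] is the limit from the right of points whose coordinates lie in the closed ball of
     radius [A * s 1 < r]. *)
  have [v hv vc] : (psi @` [set v | `|y - v| <= A * s 1]) (c tau).
    have hD : \forall x \near tau^'+, (psi @` [set v | `|y - v| <= A * s 1]) (c x).
      near=> x.
      have tx : tau < x by near: x; exact: nbhs_right_gt.
      have x1 : x <= 1 by near: x; exact: nbhs_right_le.
      have [x01 hx] := after x tx x1.
      exists (u x) => /=; first exact: u_near.
      have xx : x <= x <= 1 by rewrite lexx.
      have [dx _] := hx x xx.
      have [_ _ _ Md _] := hch; have [] // := Md (c x) _ dx.
      by apply: hc.2; exact: unit_nbhd_01.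
    have cr : c x @[x --> tau^'+] --> c tau.
      by apply: cvg_trans ctau; apply: cvg_app; exact: cvg_within.
    exact: (closed_cvg _ image_ball_closed hD _ cr).
  have hvr : `|y - v| < r := le_lt_trans hv s1r.
  have [Uv _ _ _] := bounds hvr.
  by rewrite /inside /u -vc; have [_ dv ->] := Mi v Uv.
have tau_eq0 : tau = 0.
  apply: contrapT => /eqP tau_neq0.
  have taup : 0 < tau by rewrite lt_neqAle eq_sym tau_neq0.
  have etau : unit_nbhd e tau by apply: unit_nbhd_01 => //; rewrite tau0.
  have itau : inside tau by apply: Btau.2; rewrite lexx.
  have /nbhs_ballP[d /= d0 hd] := inside_open etau itau.
  (* A time before [tau] from which the curve would still be inside, contradicting the infimum. *)
  pose x := Num.max 0 (tau - d / 2).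
  have xtau : x < tau by rewrite gt_max taup /=; lra.
  suff Bx : B x by have := ge_inf hlB Bx; rewrite leNgt -/tau xtau.
  split; first by rewrite le_max lexx /= (le_trans (ltW xtau)).
  move=> z /andP[]; rewrite ge_max => /andP[z0 zd] z1.
  have [tz|zt] := leP tau z; first by apply: Btau.2; rewrite tz.
  by apply: hd; rewrite /ball /= gtr0_norm ?subr_gt0 //; lra.
by move: Btau; rewrite tau_eq0 => -[_]; exact.
Unshelve. all: by end_near. Qed.

Let C0 : R := (m * m)%:R * K * A.
Variables (e' : R) (V : R -> 'rV[R]_n).
Hypotheses (e'0 : 0 < e') (pV : parallel (m := m) M g e' c V).
Hypothesis s1C : C0 * s 1 <= 2^-1.
Let w (t : R) := 'd phi (c t) (V t).

(** The parallel equation gives [|w'| <= C0 * sigma * |w|], with [m * m] Christoffel terms each at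
    most [K * A * sigma * |w|]. Integrating bounds the drift by [C0 * s 1] times the maximum of
    [|w|], and shortness of the curve replaces a Gronwall argument. *)
Lemma short_curve_transport : `|w 0 - w 1| <= 2 * C0 * s 1 * `|w 1|.
Proof.
have C00 : 0 <= C0 by rewrite !mulr_ge0.
have dw (t : R) : 0 <= t <= 1 -> is_derive t 1 w (derive1 w t).
  move=> t01; have [_ /(_ ch)] := pV (unit_nbhd_01 e'0 t01).
  have [dt _] := short_curve_inside t01.
  by move=> [//|dwt _]; rewrite derive1E; exact: derivableP.
have w'_le (t : R) k : 0 <= t <= 1 -> `|derive1 w t 0 k| <= C0 * sigma t * `|w t|.
  move=> t01; have [_ /(_ ch)] := pV (unit_nbhd_01 e'0 t01).
  have [dt ut] := short_curve_inside t01.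
  have et : unit_nbhd e t := unit_nbhd_01 e0 t01.
  move=> [//|_ /(_ k)/eqP]; rewrite addr_eq0 => /eqP ->; rewrite normrN.
  have [_ _ hG _] := bounds ut.
  have u'E : derive1 (fun s => phi (c s)) t = u' t.
    by rewrite derive1E; have [_ ->] := du et dt.
  rewrite u'E (le_trans (ler_norm_sum _ _ _)) //.
  have -> : C0 * sigma t * `|w t| = \sum_(i < m) \sum_(j < m) K * (A * sigma t) * `|w t|.
    by rewrite !sumr_const !card_ord -mulrnA -mulr_natl /C0 !mulrA.
  apply: ler_sum => i _; rewrite (le_trans (ler_norm_sum _ _ _)) //.
  apply: ler_sum => j _; rewrite normrM [`|christoffel _ _ _ _ _ _ * _|]normrM.
  apply: ler_pM; [by rewrite mulr_ge0| by []| |exact: norm_coord_le].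
  have h1 : `|u' t 0 i| <= A * sigma t.
    by apply: le_trans (norm_coord_le _ _) _; exact: u'_le.
  exact: (ler_pM (normr_ge0 _) (normr_ge0 _) (hG k i j) h1).
have cw : {within `[0, 1], continuous (fun t => `|w t|)}.
  apply: continuous_in_subspaceT => t /[!inE] /=; rewrite in_itv /= => t01.
  by apply: (@cvg_norm _ _ _ (nbhs t)); exact: is_derive_continuous (dw t t01).
have [t0 + ht0] := EVT_max (ler01 : 0 <= 1 :> R) cw.
rewrite in_itv /= => t001.
have s10 : 0 <= s 1 by apply: s_ge0; rewrite ler01 lexx.
have main (a : R) : 0 <= a <= 1 -> `|w a - w 1| <= C0 * s 1 * `|w t0|.
  move=> /andP[a0 a1].
  have sa : 0 <= s a by apply: s_ge0; rewrite a0.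
  apply: norm_rV_le => [|j]; first by rewrite !mulr_ge0.
  rewrite !mxE distrC.
  apply: (@le_trans _ _ (C0 * `|w t0| * (s 1 - s a))); last first.
    by rewrite mulrAC ler_wpM2r // ler_wpM2l // gerBl.
  apply: (@increment_le R s sigma (fun t => w t 0 j) (fun t => derive1 w t 0 j)) => //.
  - by apply: (continuous_subspaceW _ cs); apply: subset_itvr; rewrite bnd_simp.
  - by move=> t /andP[at_ t1]; apply: ds; rewrite t1 (le_lt_trans a0).
  - move=> t /andP[at_ t1]; apply: is_derive1_coord; apply: dw.
    by rewrite t1 (le_trans a0).
  - move=> t /andP[at_ t1].
    have t01 : 0 <= t <= 1 by rewrite (ltW t1) (le_trans a0) // ltW.
    apply: le_trans (w'_le t j t01) _.
    rewrite [leRHS]mulrAC ler_wpM2l //; first by rewrite mulr_ge0 // sqrtr_ge0.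
    by apply: ht0; rewrite in_itv.
(* Since [C0 * s 1 <= 1/2], the drift at the maximum point [t0] is absorbed into the left-hand
   side. *)
have B2 : `|w t0| <= 2 * `|w 1|.
  have h1 := main t0 t001.
  have h2 : `|w t0| <= `|w t0 - w 1| + `|w 1|.
    by rewrite -{1}[w t0](subrK (w 1)) ler_normD.
  have h3 : C0 * s 1 * `|w t0| <= 2^-1 * `|w t0| by rewrite ler_wpM2r.
  lra.
have O01 : 0 <= (0 : R) <= 1 by rewrite lexx ler01.
apply: le_trans (main 0 O01) _.
have h4 := ler_wpM2l (mulr_ge0 C00 s10) B2.
by apply: le_trans h4 _; rewrite mulrCA !mulrA.
Qed.

End ShortCurve.

(** * Convergence of tangent vectors in coordinates *)

Section Transport.
Context {R : realType} {n m : nat}.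
Variables (M : set 'rV[R]_n) (g : metric R n) (ch : chart R n m).
Hypotheses (hM : embedded_manifold m M) (hg : riemannian_metric m M g).
Variable geo : 'rV[R]_n -> 'rV[R]_n -> R -> 'rV[R]_n.
Hypothesis hgeo : geodesic_choice m M g geo.
Local Notation phi := (ch_map ch).
Local Notation psi := (ch_inv ch).

Lemma dist_ge0 x y : 0 <= dist g geo x y.
Proof. by apply: Rintegral_ge0 => t _; exact: sqrtr_ge0. Qed.

Lemma transport_chart_le y : M y -> chart_at M y ch ->
  exists C eps : R, [/\ 0 <= C, 0 < eps &
    forall x e V, M x -> dist g geo x y < eps -> 0 < e ->
      parallel (m := m) M g e (geo x y) V ->
      `|'d phi x (V 0) - 'd phi y (V 1)| <= C * dist g geo x y * `|'d phi y (V 1)|].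
Proof.
move=> My [hch dy]; have [_ _ _ Md _] := hch; have [Uy yK] := Md y My dy.
have [k [K [k0 K0 hK]]] := gram_bounds hg hch Uy.
have /nbhs_ballP[r /= r0 hr] := hK.
have bounds u : `|phi y - u| < r -> [/\ ch_img ch u, forall i j, `|gram g ch u i j| <= K,
     forall k i j, `|christoffel g ch u k i j| <= K &
     forall a, k * `|a| ^+ 2 <= gram_form g ch u a a].
  by move=> yu; apply: hr; rewrite -ball_normE.
pose A := (Num.sqrt k)^-1.
have A0 : 0 <= A by rewrite invr_ge0 sqrtr_ge0.
pose C0 : R := (m * m)%:R * K * A.
have C00 : 0 <= C0 by rewrite !mulr_ge0.
have A1 : 0 < A + 1 by rewrite ltr_wpDl.
have C1 : 0 < C0 + 1 by rewrite ltr_wpDl.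
(* The first bound keeps the geodesic in the coordinate ball of radius [r], the second makes [C0]
   times its length at most [1/2]. Adding 1 keeps the denominators positive. *)
exists (2 * C0), (Num.min (r / (A + 1)) (2^-1 / (C0 + 1))); split.
- by rewrite mulr_ge0.
- by rewrite lt_min !divr_gt0 ?invr_gt0.
move=> x e' V Mx; rewrite lt_min => /andP[].
have l0 := dist_ge0 x y.
rewrite !ltr_pdivlMr // => l1 l2 e'0 pV.
have [[[e [e0 hc2 _]] c0 c1 _] _] := hgeo Mx My.
have hc : curve_of_class 1 M e (geo x y) by case: hc2 => /Ck_leq.
have [s [s0 s1 cs ds]] := arc_length hM hg e0 hc.
rewrite -/(dist g geo x y) in s1.
have c1' : geo x y 1 = psi (phi y) by rewrite c1 yK.
have sr : A * s 1 < r.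
  by rewrite s1 mulrC (le_lt_trans _ l1) // ler_wpM2l // lerDl.
have sC : C0 * s 1 <= 2^-1.
  by rewrite s1 mulrC (le_trans _ (ltW l2)) // ler_wpM2l // lerDl.
have := short_curve_transport hg hch r0 k0 K0 bounds e0 hc c1' s0 cs ds sr e'0 pV sC.
by rewrite c0 c1 s1.
Qed.

Lemma dist_cvg0 y (y_ : nat -> 'rV[R]_n) : chart_at M y ch -> M y ->
  (forall k, M (y_ k)) -> y_ k @[k --> \oo] --> y ->
  dist g geo (y_ k) y @[k --> \oo] --> (0 : R).
Proof.
move=> [hch dy] My M_ yy; have [[od oi] _ _ Md _] := hch.
have [Uy yK] := Md y My dy.
have [K K0 hK] := dist_chart_le hM hg hch hgeo Uy.
have cphi : phi (y_ k) @[k --> \oo] --> phi y.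
  apply: (@continuous_cvg nat 'rV[R]_n 'rV[R]_m _ _ y_ phi y) yy.
  exact: (differentiable_continuous ((chart_map_C1 hch).1 _ dy)).
have H : K * `|phi y - phi (y_ k)| @[k --> \oo] --> (0 : R).
  rewrite -[X in _ --> X](mulr0 K); apply: cvgMr.
  rewrite -[X in _ --> X](normr0 'rV[R]_m) -(subrr (phi y)).
  by apply: cvg_norm; apply: cvgB => //; exact: cvg_cst.
apply: (@squeeze_cvgr _ _ _ _ (cst 0)); [ |exact: cvg_cst|exact: H].
near=> k; rewrite dist_ge0 /=.
have dk : ch_dom ch (y_ k) by near: k; apply: yy; exact: open_nbhs_nbhs.
have [_ ykK] := Md _ (M_ k) dk.
rewrite -{1}ykK -{1}yK; near: k.
exact: (cvg_pair cphi (cvg_cst (phi y)) hK).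
Unshelve. all: by end_near. Qed.

Lemma chart_norm_le y : M y -> chart_at M y ch ->
  exists2 A : R, 0 <= A & forall v w, tangent M y v -> tangent M y w ->
    `|'d phi y v - 'd phi y w| <= A * riem_norm g y (v - w).
Proof.
move=> My [hch dy]; have [_ _ _ Md _] := hch; have [Uy yK] := Md y My dy.
have [k k0 hk] := gram_form_coercive_at hg hch Uy.
have sk : 0 < Num.sqrt k by rewrite sqrtr_gt0.
exists (Num.sqrt k)^-1; first by rewrite invr_ge0 ltW.
move=> v w Tv Tw.
have E : v - w = 'd psi (phi y) ('d phi y v - 'd phi y w).
  by rewrite linearB /= !(chart_diff_invK hch My dy).
have Tvw : tangent M y (v - w) by rewrite E -{1}yK; exact: chart_tangent.
rewrite /riem_norm (metric_chart hg hch My dy Tvw Tvw) linearB /= ler_pdivlMl //.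
set a := _ - _.
have -> : Num.sqrt k * `|a| = Num.sqrt (k * `|a| ^+ 2).
  by rewrite sqrtrM ?ltW // sqrtr_sqr normr_id.
exact/ler_wsqrtr/hk.
Qed.

(* Along [geo] an undefined transport would be the default value [0], leaving
   [dist_star] equal to the nonzero norm of [v]; so convergence itself
   provides the parallel fields. *)
Lemma tangent_cvg_chart y v (y_ v_ : nat -> 'rV[R]_n) :
  M y -> chart_at M y ch -> (forall k, M (y_ k)) -> tangent M y v ->
  0 < riem_norm g y v -> tangent_cvg (m := m) M g geo y_ v_ y v ->
  'd phi (y_ k) (v_ k) @[k --> \oo] --> 'd phi y v.
Proof.
move=> My hy M_ Tv nv [yy ds].
have [A A0 hA] := chart_norm_le My hy.
have [C [eps [C0 eps0 hC]]] := transport_chart_le My hy.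
pose p k := ptransport (m := m) M g geo (y_ k) y (v_ k).
pose ell k := dist g geo (y_ k) y.
pose del k := dist_star (m := m) M g geo (y_ k) (v_ k) y v.
have ell0 : ell k @[k --> \oo] --> (0 : R) by exact: dist_cvg0.
pose W := 'd phi y v.
(* The error bound has two parts: the gap between the transported vector [p k] and [v], and the
   drift along the geodesic, proportional to its length and to the coordinate norm of [p k], itself
   at most [A * del k + |W|]. *)
have H : A * del k + C * ell k * (A * del k + `|W|) @[k --> \oo] --> (0 : R).
  have hd : A * del k @[k --> \oo] --> (0 : R) by rewrite -[X in _ --> X](mulr0 A); exact: cvgMr.
  have hl : C * ell k @[k --> \oo] --> (0 : R) by rewrite -[X in _ --> X](mulr0 C); exact: cvgMr.
  rewrite -[X in _ --> X]addr0 -[X in _ + X](mul0r (0 + `|W|)).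
  by apply: cvgD => //; apply: cvgM => //; apply: cvgD => //; exact: cvg_cst.
apply/subr_cvg0; apply/norm_cvg0P.
apply: (@squeeze_cvgr _ _ _ _ (cst 0)); [ |exact: cvg_cst|exact: H].
have hdel : \forall k \near \oo, del k < riem_norm g y v by exact: (cvgr_lt 0 ds).
have hell : \forall k \near \oo, ell k < eps by exact: (cvgr_lt 0 ell0).
near=> k; rewrite normr_ge0 /=.
have dk : del k < riem_norm g y v by near: k.
have lk : ell k < eps by near: k.
have [e [V [e0 pV V0 V1]]] : exists (e : R) (V : R -> 'rV[R]_n),
    [/\ 0 < e, parallel (m := m) M g e (geo (y_ k) y) V, V 0 = v_ k & V 1 = p k].
  rewrite /p /ptransport; case: xgetP => [w -> //|noV].
  by move: dk; rewrite /del /dist_star /ptransport (xgetPN _ noV) subr0 ltxx.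
have [_ c0 c1 _] := (hgeo (M_ k) My).1.
have Tp : tangent M y (p k).
  have O01 : 0 <= (1 : R) <= 1 by rewrite ler01 lexx.
  by have [] := pV 1 (unit_nbhd_01 e0 O01); rewrite c1 V1.
have h1 := hC _ _ _ (M_ k) lk e0 pV; rewrite V0 V1 -/(ell k) in h1.
have h2 : `|W - 'd phi y (p k)| <= A * del k := hA _ _ Tv Tp.
have h3 : `|'d phi y (p k)| <= A * del k + `|W|.
  rewrite -[X in `|X|](subrK W) (le_trans (ler_normD _ _)) // lerD2r.
  by rewrite distrC.
have h4 : C * ell k * `|'d phi y (p k)| <= C * ell k * (A * del k + `|W|).
  by rewrite ler_wpM2l // mulr_ge0 // dist_ge0.
rewrite -[X in `|X|](subrKA ('d phi y (p k))) (le_trans (ler_normD _ _)) //.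
rewrite addrC lerD //; first by rewrite distrC.
exact: le_trans h1 h4.
Unshelve. all: by end_near. Qed.

End Transport.

(** * The direct search iteration *)

(** The upper limit is an infimum of suprema over neighbourhoods, and each neighbourhood contains
    [(y_ k, t_ k)] for all large [k]. One sequence of quotients with nonnegative lower limit is
    therefore enough. *)
Lemma clarke_deriv_ge0 (R : realType) (m : nat) (h : 'rV[R]_m -> R) (y w : 'rV[R]_m)
    (y_ : nat -> 'rV[R]_m) (t_ : nat -> R) :
  y_ k @[k --> \oo] --> y -> t_ k @[k --> \oo] --> (0 : R) -> (forall k, 0 < t_ k) ->
  (forall eps : R, 0 < eps -> \forall k \near \oo,
    - eps <= (h (y_ k + t_ k *: w) - h (y_ k)) / t_ k) ->
  (0 <= clarke_deriv h y w)%E.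
Proof.
move=> yy tt t0 hq; apply: le_ereal_inf_tmp => _ [V hV <-].
apply/lee_addgt0Pr => eps eps0.
have hyt : \forall k \near \oo, V (y_ k, t_ k).
  have [[A B] /= [hA hB] AB] := hV.
  have {}hB : \forall k \near \oo, B (t_ k).
    (* The filter [0^'+] sees only positive reals, so positivity of [t_ k] joins the convergence to
       0. *)
    by near=> k; have := t0 k; near: k; exact: (tt _ hB).
  by have := yy _ hA; apply: filterS2 hB => k Bk Ak; exact: AB.
have [k [Vk qk]] : exists k, V (y_ k, t_ k) /\
    - eps <= (h (y_ k + t_ k *: w) - h (y_ k)) / t_ k.
  by apply: (@filter_ex _ \oo); apply: filterI; [exact: hyt|exact: (hq _ eps0)].
rewrite -leeBlDr // sub0e.
apply: (@le_trans _ _ ((h (y_ k + t_ k *: w) - h (y_ k)) / t_ k)%:E).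
  by rewrite -EFinN lee_fin.
by apply: ereal_sup_ubound; exists (y_ k, t_ k).
Unshelve. all: by end_near. Qed.

Section Algorithm.
Context {R : realType} {n m : nat}.
Variables (M : set 'rV[R]_n) (g : metric R n).
Hypotheses (hM : embedded_manifold m M).

Lemma tangentZ x v (a : R) : M x -> tangent M x v -> tangent M x (a *: v).
Proof.
move=> Mx Tv; have [ch [hch dx]] := hM Mx.
have [_ _ _ Md _] := hch; have [Ux xK] := Md x Mx dx.
rewrite -(chart_diff_invK hch Mx dx Tv) -linearZ /= -{1}xK; exact: chart_tangent.
Qed.

Lemma tangent0 x : M x -> tangent M x 0.
Proof.
move=> Mx; have [ch [hch dx]] := hM Mx.
have [_ _ _ Md _] := hch; have [Ux xK] := Md x Mx dx.
rewrite -(linear0 ('d (ch_inv ch) (ch_map ch x))) -{1}xK; exact: chart_tangent.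
Qed.

Lemma search_dir_tangent x db : M x -> tangent M x (search_dir M g x db).
Proof.
move=> Mx; rewrite /search_dir; case: ifPn => [_|]; first exact: tangent0.
rewrite /orthproj; case: xgetP => [p -> [Tp _] _|_]; first exact: tangentZ.
(* Without a projection [xget] would return 0, which this branch excludes. *)
by rewrite eqxx.
Qed.

Variables (f : 'rV[R]_n -> R) (Rt : 'rV[R]_n -> 'rV[R]_n -> 'rV[R]_n).
Hypothesis hRt : retraction m M Rt.
Variables (x0 : 'rV[R]_n) (alpha0 gamma gamma1 gamma2 : R).
Variables (dbar x_ d_ : nat -> 'rV[R]_n) (alpha_ : nat -> R).
Hypothesis halg : rds_dd M g f Rt x0 alpha0 gamma gamma1 gamma2 dbar x_ alpha_ d_.
Hypothesis Mx0 : M x0.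

Lemma rds_iterate_mem k : M (x_ k).
Proof.
have [x_0 _ step] := halg; elim: k => [|k IH]; first by rewrite x_0.
have [dk -> _] := step k; case: ifP => // _.
have [RM _ _ _] := hRt; apply: RM => //; apply: tangentZ => //.
by rewrite dk; exact: search_dir_tangent.
Qed.

Lemma rds_dir_tangent k : tangent M (x_ k) (d_ k).
Proof.
have [_ _ step] := halg; have [-> _ _] := step k.
by apply: search_dir_tangent; exact: rds_iterate_mem.
Qed.

Hypotheses (halpha0 : 0 < alpha0) (hgamma : 0 < gamma).
Hypotheses (hgamma1 : 0 < gamma1 < 1) (hgamma2 : 1 <= gamma2).

Lemma rds_step_gt0 k : 0 < alpha_ k.
Proof.
have [_ a0 step] := halg; elim: k => [|k IH]; first by rewrite a0.
have [_ _ ->] := step k; apply: mulr_gt0 => //.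
by case: ifP => _; [exact: lt_le_trans hgamma2|case/andP: hgamma1].
Qed.

Hypothesis hfbnd : bounded_below_on M f.

(* The potential [alpha_k^2 + gamma2^2 / gamma * f x_k] decreases by at least
   [(1 - gamma1^2) * alpha_k^2] at every iteration. *)
Lemma rds_step_cvg0 : alpha_ k @[k --> \oo] --> (0 : R).
Proof.
have [x_0 a0 step] := halg; have [b hb] := hfbnd.
have /andP[g10 g11] := hgamma1.
(* With this weight the decrease of [C * f] at a successful step pays exactly for the new value
   [gamma2^2 * alpha_k^2] of the squared step size. *)
pose C := gamma2 ^+ 2 / gamma.
have C0 : 0 <= C by rewrite divr_ge0 ?sqr_ge0 // ltW.
have g1sq : 0 < 1 - gamma1 ^+ 2 by rewrite subr_gt0 expr_lt1 // ltW.
pose pot k := alpha_ k ^+ 2 + C * f (x_ k).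
have dec k : (1 - gamma1 ^+ 2) * alpha_ k ^+ 2 + pot k.+1 <= pot k.
  rewrite /pot; have [_ -> ->] := step k.
  case: ifP => [succ|_]; last by rewrite exprMn; lra.
  have : C * f (Rt (x_ k) (alpha_ k *: d_ k)) <= C * (f (x_ k) - gamma * alpha_ k ^+ 2).
    by rewrite ler_wpM2l.
  have -> : C * (f (x_ k) - gamma * alpha_ k ^+ 2) = C * f (x_ k) - gamma2 ^+ 2 * alpha_ k ^+ 2.
    by rewrite /C; field; exact: lt0r_neq0.
  rewrite exprMn.
  have : 0 <= gamma1 ^+ 2 * alpha_ k ^+ 2 by rewrite mulr_ge0 ?sqr_ge0.
  move: (_ * f _) (_ * f _) => X Y; lra.
have sum_le N : (1 - gamma1 ^+ 2) * series (fun k => alpha_ k ^+ 2) N + pot N <= pot 0%N.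
  elim: N => [|N IH]; first by rewrite /series /= big_geq // mulr0 add0r.
  rewrite /series /= big_nat_recr //= mulrDr.
  apply: le_trans IH; rewrite -addrA lerD2l; exact: dec.
have cs : cvgn (series (fun k => alpha_ k ^+ 2)).
  apply: nondecreasing_is_cvgn.
    by apply: nondecreasing_series => k _ _; exact: sqr_ge0.
  (* The decreases telescope, and the potential stays above [C * b]; hence the squared step sizes
     are summable. *)
  exists ((pot 0%N - C * b) / (1 - gamma1 ^+ 2)) => _ [N _ <-].
  rewrite ler_pdivlMr // mulrC.
  have h1 := sum_le N; have h2 : C * b <= C * f (x_ N).
    by rewrite ler_wpM2l // hb //; exact: rds_iterate_mem.
  have h3 := sqr_ge0 (alpha_ N); move: h1; rewrite {1}/pot; lra.
have sq0 := cvg_series_cvg_0 cs.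
have -> : alpha_ = fun k => Num.sqrt (alpha_ k ^+ 2).
  by apply/funext => k; rewrite sqrtr_sqr gtr0_norm // rds_step_gt0.
rewrite -[X in _ --> X](@sqrtr0 R).
apply: (@continuous_cvg nat R R _ _ (fun k => alpha_ k ^+ 2) Num.sqrt 0) sq0.
exact: sqrt_continuous.
Qed.

End Algorithm.

Lemma cvg_increasing_nat (i : nat -> nat) : {homo i : a b / (a < b)%N} ->
  i k @[k --> \oo] --> \oo.
Proof.
move=> hi A [N _ hN].
have le_i k : (k <= i k)%N.
  by elim: k => // k IH; apply: leq_ltn_trans IH _; exact: hi.
by exists N => // k /= Nk; apply: hN => /=; exact: leq_trans (le_i k).
Qed.

(** * First-order estimates for the objective and the retraction *)

Section Main.
Context {R : realType} {n m : nat}.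
Variables (M : set 'rV[R]_n) (g : metric R n) (ch : chart R n m).
Hypotheses (hM : embedded_manifold m M) (hg : riemannian_metric m M g).
Variable geo : 'rV[R]_n -> 'rV[R]_n -> R -> 'rV[R]_n.
Hypothesis hgeo : geodesic_choice m M g geo.
Local Notation phi := (ch_map ch).
Local Notation psi := (ch_inv ch).

(** Passes from the Riemannian distance to the coordinate norm and then to the ambient norm, so that
    function values at two nearby points of [M] can be compared through their difference in the
    ambient space. *)
Lemma lipschitz_dist_chart f x : lipschitz_dist M g geo f -> chart_at M x ch -> M x ->
  exists2 L : R, 0 <= L & \forall z \near x & z' \near x, M z -> M z' ->
    `|f z' - f z| <= L * `|z' - z|.
Proof.
move=> [L hL] [hch dx] Mx; have [[od oi] _ _ Md _] := hch.
have [Ux xK] := Md x Mx dx.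
have [K K0 hK] := dist_chart_le hM hg hch hgeo Ux.
have [K' K'0 hK'] := row_C1_locally_lipschitz od (chart_map_C1 hch) dx.
have cphi : phi z @[z --> x] --> phi x := differentiable_continuous ((chart_map_C1 hch).1 _ dx).
exists (`|L| * (K * K')); first by rewrite !mulr_ge0.
have hd : \forall z \near x & z' \near x, ch_dom ch z /\ ch_dom ch z'.
  have dom_x : nbhs x (ch_dom ch) by exact: open_nbhs_nbhs.
  by exists (ch_dom ch, ch_dom ch).
have hphi : \forall z \near x & z' \near x,
    dist g geo (psi (phi z)) (psi (phi z')) <= K * `|phi z' - phi z|.
  have cz : phi zz.1 @[zz --> filter_prod (nbhs x) (nbhs x)] --> phi x.
    exact: cvg_comp cvg_fst cphi.
  have cz' : phi zz.2 @[zz --> filter_prod (nbhs x) (nbhs x)] --> phi x.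
    exact: cvg_comp cvg_snd cphi.
  exact: (cvg_pair cz cz' hK).
apply: filterS3 hd hK' hphi => -[z z'] /= [dz dz'] h1 h2 Mz Mz'.
have [_ zK] := Md z Mz dz; have [_ z'K] := Md z' Mz' dz'.
rewrite zK z'K in h2.
have d0 := dist_ge0 g geo z z'.
rewrite distrC (le_trans (hL _ _ Mz Mz')) //.
apply: (@le_trans _ _ (`|L| * dist g geo z z')); first by rewrite ler_wpM2r // ler_norm.
by rewrite -mulrA ler_wpM2l // (le_trans h2) // -mulrA ler_wpM2l.
Qed.

Variable Rt : 'rV[R]_n -> 'rV[R]_n -> 'rV[R]_n.
Hypothesis hRt : retraction m M Rt.

(** In tangent bundle coordinates these are difference quotients at [(y_ k, 0)] in the fibre
    direction [(0, a_ k)]. They converge to the fibre derivative at [(phi x, 0)], which the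
    first-order retraction condition identifies with [d]. *)
Lemma retraction_cvg_quotient x d (y_ a_ : nat -> 'rV[R]_m) (t_ : nat -> R) :
  chart_at M x ch -> M x -> tangent M x d ->
  y_ k @[k --> \oo] --> phi x -> a_ k @[k --> \oo] --> 'd phi x d ->
  (forall k, 0 < t_ k) -> t_ k @[k --> \oo] --> (0 : R) ->
  (t_ k)^-1 *: (Rt (psi (y_ k)) ('d psi (y_ k) (t_ k *: a_ k)) - psi (y_ k))
    @[k --> \oo] --> d.
Proof.
move=> [hch dx] Mx Td yy aa t0 tt; have [[od oi] _ _ Md Mi] := hch.
have [Ux xK] := Md x Mx dx.
have [_ /(_ ch hch) FC1 R0 dR] := hRt.
pose F (p : 'rV[R]_m * 'rV[R]_m) := Rt (psi p.1) ('d psi (p.1) (p.2)).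
pose U : set ('rV[R]_m * 'rV[R]_m) := [set p | ch_img ch p.1].
rewrite -/U -/F in FC1.
have Uo : open U.
  apply: (@open_comp _ _ fst (ch_img ch)) => // p _; exact: cvg_fst.
pose p : 'rV[R]_m * 'rV[R]_m := (phi x, 0).
have Up : U p by [].
have h := @pair_C1_cvg_quotient R m m n U F p (0, 'd phi x d)
   (fun k => (y_ k, 0)) (fun k => (0, a_ k)) t_ Uo FC1 Up.
have {}h : (t_ k)^-1 *: (F ((y_ k, 0) + t_ k *: (0, a_ k)) - F (y_ k, 0))
    @[k --> \oo] --> 'd F p (0, 'd phi x d).
  apply: h => //.
    exact: (cvg_pair yy (cvg_cst (0 : 'rV[R]_m))).
  exact: (cvg_pair (cvg_cst (0 : 'rV[R]_m)) aa).
have dF : 'd F p (0, 'd phi x d) = d.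
  have dl := is_derive_line p (0, 'd phi x d) 0.
  have E : p + 0 *: (0, 'd phi x d) = p by rewrite scale0r addr0.
  have d1 : differentiable F (p + 0 *: (0, 'd phi x d)) by rewrite E; apply: FC1.1.
  have := @is_derive1_diff _ _ _ F (fun s : R => p + s *: (0, 'd phi x d)) 0 _ d1 dl.
  rewrite E => -[_ <-].
  have -> : F \o (fun s : R => p + s *: (0, 'd phi x d)) = fun s : R => Rt x (s *: d).
    apply/funext => s.
    by rewrite /F /= scaler0 addr0 add0r linearZ /= xK (chart_diff_invK hch Mx dx Td).
  by have [_ ->] := dR x d Mx Td.
rewrite dF in h; move: h; apply: cvg_trans; apply: near_eq_cvg; near=> k.
have Uy : ch_img ch (y_ k) by near: k; apply: yy; exact: open_nbhs_nbhs.
rewrite /F /= scaler0 addr0 add0r linear0 R0 //.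
by have [] := Mi _ Uy.
Unshelve. all: by end_near. Qed.

End Main.

(** * Clarke stationarity of the limit point *)

Unset Implicit Arguments.

Theorem theorem4p1
  (R : realType) (n m : nat)
  (M : set 'rV[R]_n) (g : metric R n)
  (hM : embedded_manifold m M)
  (hg : riemannian_metric m M g)
  (geo : 'rV[R]_n -> 'rV[R]_n -> R -> 'rV[R]_n)
  (hgeo : geodesic_choice m M g geo)
  (f : 'rV[R]_n -> R)
  (hflip : lipschitz_dist M g geo f)
  (hfbnd : bounded_below_on M f)
  (Rt : 'rV[R]_n -> 'rV[R]_n -> 'rV[R]_n)
  (hRt : retraction m M Rt)
  (Lr : R) (hLr : 0 < Lr)
  (hRtL : forall x d, M x -> tangent M x d ->
     dist g geo (Rt x d) x <= Lr * riem_norm g x d)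
  (x0 : 'rV[R]_n) (alpha0 gamma gamma1 gamma2 : R)
  (hx0 : M x0) (halpha0 : 0 < alpha0) (hgamma : 0 < gamma)
  (hgamma1 : 0 < gamma1 < 1) (hgamma2 : 1 <= gamma2)
  (dbar : nat -> 'rV[R]_n)
  (hdbar : forall k, sphere R n (dbar k))
  (hdense : sphere R n `<=` closure (range dbar))
  (x_ : nat -> 'rV[R]_n) (alpha_ : nat -> R) (d_ : nat -> 'rV[R]_n)
  (halg : rds_dd M g f Rt x0 alpha0 gamma gamma1 gamma2 dbar x_ alpha_ d_)
  (i : nat -> nat) (xstar : 'rV[R]_n)
  (href : refining m M g geo x_ d_ i xstar)
  (hunsucc : forall k,
     ~~ successful f Rt gamma (x_ (i k)) (alpha_ (i k)) (d_ (i k))) :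
  clarke_stationary m M f xstar.
Proof.
have [i_inc Mx _ dir_cvg] := href.
move=> ch [hch dx] d Td; rewrite /clarke_dir.
set phi := ch_map ch; set psi := ch_inv ch.
have [[od oi] _ _ Md Mi] := hch; have [Ux xK] := Md xstar Mx dx.
(* The refining property concerns unit vectors, so the zero direction is separate: its quotients
   vanish along any positive null sequence. *)
have [->|d0] := eqVneq d 0.
  rewrite linear0.
  apply: (@clarke_deriv_ge0 R m _ _ _ (fun=> phi xstar) harmonic).
  - exact: cvg_cst.
  - exact: cvg_harmonic.
  - exact: harmonic_gt0.
  by move=> eps eps0; near=> k; rewrite scaler0 addr0 subrr mul0r oppr_le0 ltW.
pose rho := riem_norm g xstar d.
have rho0 : 0 < rho by rewrite sqrtr_gt0; have [_ _ gpos _] := hg; exact: gpos.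
pose d' := rho^-1 *: d.
have Td' : tangent M xstar d' by exact: (tangentZ hM).
have nd' : riem_norm g xstar d' = 1.
  rewrite /riem_norm (metric_chart hg hch Mx dx Td' Td') linearZ /= gram_form_scale.
  rewrite -(metric_chart hg hch Mx dx Td Td) sqrtrM ?sqr_ge0 // sqrtr_sqr.
  by rewrite gtr0_norm ?invr_gt0 // -/(riem_norm g xstar d) mulVf ?lt0r_neq0.
have [j j_inc tcvg] := dir_cvg d' Td' nd'.
pose X k := x_ (i (j k)); pose D k := d_ (i (j k)); pose al k := alpha_ (i (j k)).
have MX k : M (X k) := rds_iterate_mem hM hRt halg hx0 _.
have TD k : tangent M (X k) (D k) := rds_dir_tangent hM hRt halg hx0 _.
have al_gt0 k : 0 < al k := rds_step_gt0 halg halpha0 hgamma1 hgamma2 _.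
have al0 : al k @[k --> \oo] --> (0 : R).
  have ij_inc : {homo i \o j : a b / (a < b)%N} by move=> a b /j_inc/i_inc.
  exact: (cvg_comp _ _ (cvg_increasing_nat ij_inc)
    (rds_step_cvg0 hM hRt halg hx0 halpha0 hgamma hgamma1 hgamma2 hfbnd)).
have XX : X k @[k --> \oo] --> xstar by case: tcvg.
pose w' := 'd phi xstar d'; pose a k := 'd phi (X k) (D k); pose y k := phi (X k).
have aa : a k @[k --> \oo] --> w'.
  by apply: (tangent_cvg_chart hM hg hgeo) tcvg => //; rewrite nd'.
have yy : y k @[k --> \oo] --> phi xstar.
  apply: (@continuous_cvg nat 'rV[R]_n 'rV[R]_m _ _ X phi xstar) XX.
  exact: (differentiable_continuous ((chart_map_C1 hch).1 _ dx)).
have cpsi : {for phi xstar, continuous psi}.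
  exact: (differentiable_continuous ((chart_inv_C1 hch).1 _ Ux)).
(* [Z k] will be the trial point of the algorithm, and [Y k] the point reached by a straight
   coordinate step in the limit direction [w']. *)
pose Z k := Rt (psi (y k)) ('d psi (y k) (al k *: a k)).
pose Y k := psi (y k + al k *: w').
have Q1 : (al k)^-1 *: (Z k - psi (y k)) @[k --> \oo] --> d'.
  exact: (retraction_cvg_quotient hRt (conj hch dx) Mx Td' yy aa al_gt0 al0).
have Q2 : (al k)^-1 *: (Y k - psi (y k)) @[k --> \oo] --> d'.
  rewrite -[X in _ --> X](chart_diff_invK hch Mx dx Td').
  exact: (row_C1_cvg_quotient oi (chart_inv_C1 hch) Ux yy (cvg_cst _) al_gt0 al0).
(* Both scaled increments tend to [d'], so the scaled gap between [Z k] and [Y k] tends to 0. *)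
pose E k := `|(al k)^-1 *: (Z k - Y k)|.
have E0 : E k @[k --> \oo] --> (0 : R).
  rewrite -[X in _ --> X](normr0 'rV[R]_n) -(subrr d'); apply: cvg_norm.
  have -> : (fun k => (al k)^-1 *: (Z k - Y k)) =
      (fun k => (al k)^-1 *: (Z k - psi (y k)) - (al k)^-1 *: (Y k - psi (y k))).
    by apply/funext => k; rewrite -scalerBr opprB addrA subrK.
  exact: cvgB.
have yw : y k + al k *: w' @[k --> \oo] --> phi xstar.
  have h : al k *: w' @[k --> \oo] --> (0 : 'rV[R]_m).
    by rewrite -[X in _ --> X](scale0r w'); exact: cvgZr_tmp.
  by rewrite -[X in _ --> X]addr0; exact: (cvgD yy h).
have YY : Y k @[k --> \oo] --> xstar.
  rewrite -[X in _ --> X]xK.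
  exact: (@continuous_cvg nat 'rV[R]_m 'rV[R]_n _ _ (fun k => y k + al k *: w') psi (phi xstar)).
have ZZ : Z k @[k --> \oo] --> xstar.
  have -> : Z = fun k => Y k + al k *: ((al k)^-1 *: (Z k - Y k)).
    by apply/funext => k; rewrite scalerKV ?lt0r_neq0 // subrKC.
  have h : al k *: ((al k)^-1 *: (Z k - Y k)) @[k --> \oo] --> (0 : 'rV[R]_n).
    have hE : (al k)^-1 *: (Z k - Y k) @[k --> \oo] --> (0 : 'rV[R]_n) by exact/norm_cvg0P.
    by rewrite -[X in _ --> X](scale0r (0 : 'rV[R]_n)); exact: (cvgZ al0 hE).
  by rewrite -[X in _ --> X]addr0; exact: (cvgD YY h).
have [L L0 hL] := lipschitz_dist_chart hM hg hgeo hflip (conj hch dx) Mx.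
(* A step [al k] along the normalized direction [w'] is a step [al k / rho] along the coordinates of
   [d]. *)
apply: (@clarke_deriv_ge0 R m _ _ _ y (fun k => al k / rho)) => //.
- by rewrite -[X in _ --> X](mul0r rho^-1); apply: cvgMl.
- by move=> k; exact: divr_gt0.
move=> eps eps0.
(* The negative of this expression will bound the Clarke quotient from below: [gamma * al k] comes
   from the failed decrease test, [L * E k] from replacing [Z k] by [Y k]. *)
have small : rho * (gamma * al k + L * E k) @[k --> \oo] --> (0 : R).
  have h1 : gamma * al k @[k --> \oo] --> gamma * 0 by exact: cvgMr.
  have h2 : L * E k @[k --> \oo] --> L * 0 by exact: cvgMr.
  have h3 : rho * (gamma * al k + L * E k) @[k --> \oo] --> rho * (gamma * 0 + L * 0).
    by apply: cvgMr; exact: (cvgD h1 h2).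
  by rewrite !mulr0 addr0 mulr0 in h3.
have hZY : \forall k \near \oo, M (Z k) -> M (Y k) -> `|f (Y k) - f (Z k)| <= L * `|Y k - Z k|.
  exact: (cvg_pair ZZ YY hL).
near=> k.
have dX : ch_dom ch (X k) by near: k; apply: XX; exact: open_nbhs_nbhs.
have XK : psi (y k) = X k by have [] := Md _ (MX k) dX.
have ZE : Z k = Rt (X k) (al k *: D k).
  by rewrite /Z XK linearZ /= [X in _ *: X](chart_diff_invK hch (MX k) dX (TD k)).
have MZ : M (Z k).
  by have [RM _ _ _] := hRt; rewrite ZE; apply: RM => //; exact: (tangentZ hM).
have MY : M (Y k).
  have Uyw : ch_img ch (y k + al k *: w') by near: k; apply: yw; exact: open_nbhs_nbhs.
  by have [] := Mi _ Uyw.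
have fZY : `|f (Y k) - f (Z k)| <= L * `|Y k - Z k| by move: MZ MY; near: k.
(* The failed decrease test, read at [Z k], which is the actual trial point once [X k] lies in the
   chart domain. *)
have fX : f (X k) - gamma * al k ^+ 2 < f (Z k).
  by have := hunsucc (j k); rewrite /successful -ltNge ZE.
have sk : rho * (gamma * al k + L * E k) <= eps by near: k; exact: (cvgr_le 0 small).
have EE : `|Y k - Z k| = al k * E k.
  by rewrite /E distrC normrZ gtr0_norm ?invr_gt0 // mulrA mulfV ?mul1r ?lt0r_neq0.
have -> : (f \o psi) (y k + al k / rho *: 'd phi xstar d) = f (Y k).
  by rewrite /Y /w' /d' /= linearZ /= scalerA.
rewrite /= XK invf_div mulrA ler_pdivlMr //.
rewrite EE ler_norml in fZY; case/andP: fZY => fZY _.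
have al_k := al_gt0 k; have rho_k := rho0.
have h1 : - (gamma * al k ^+ 2 + L * (al k * E k)) <= f (Y k) - f (X k) by lra.
have h2 := ler_wpM2r (ltW rho0) h1.
apply: le_trans h2; rewrite mulNr lerNl mulNr opprK.
have h3 := ler_wpM2r (ltW al_k) sk.
by apply: le_trans h3; rewrite le_eqVlt; apply/orP; left; apply/eqP; ring.
Unshelve. all: by end_near. Qed.
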